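(* Up to Euclidean motions, there are only six convex tangential LEQs: - the $4\times 4$ square; - the isosceles trapezoid of side lengths $5,2,5,8$; - the right trapezoid of side lengths $5,3,4,6$; - the equable rhombus of side length $5$; - the equable kite of side lengths $3$ and $15$; - the LEQ with vertices $(0,0),(40,9),(36,12),(35,12)$, and sides $37,1,5,41$.
   Context: A quadrilateral is given by four cyclically ordered points of the plane, no three colinear, such that the four sides have no interior points of intersection. A quadrilateral is equable if its area equals its perimeter. A lattice equable quadrilateral (LEQ) is an equable quadrilateral whose vertices lie on $\mathbb Z^2$. A convex quadrilateral is tangential if it has an incircle (a circle inside it tangent to its four sides); equivalently, by Pitot's theorem, consecutive side lengths $a,b,c,d$ satisfy $a+c=b+d$. Euclidean motions are elements of the group generated by translations, rotations and reflections of the plane. Side lengths in the list are given in consecutive (cyclic) order. *)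

(* Defs.v *)
From HB Require Import structures.
From mathcomp Require Import all_boot all_order all_algebra.
From mathcomp Require Import all_classical all_reals all_analysis.

Set Implicit Arguments.
Unset Strict Implicit.
Unset Printing Implicit Defensive.

Import Order.TTheory GRing.Theory Num.Theory numFieldNormedType.Exports.

Local Open Scope classical_set_scope.
Local Open Scope ring_scope.

Notation plane R := (R * R)%type.

Section Plane.
Variable R : realType.
Implicit Types p q r a b c u v : plane R.

Definition dot u v : R := u.1 * v.1 + u.2 * v.2.

(* The Euclidean distance; the library norm on a product is the sup norm. *)
Definition dist p q : R := Num.sqrt (dot (q - p) (q - p)).

Definition parallel u v : Prop := u.1 * v.2 = u.2 * v.1.

Definition segment p q : set (plane R) :=
  [set (1 - t) *: p + t *: q | t in `[0, 1]].

Definition open_segment p q : set (plane R) :=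
  [set (1 - t) *: p + t *: q | t in `]0, 1[].

Definition line p q : set (plane R) :=
  [set (1 - t) *: p + t *: q | t in [set: R]].

Definition collinear p q r : Prop :=
  exists a b, [/\ a <> b, line a b p, line a b q & line a b r].

Definition circle c (rho : R) : set (plane R) := [set p | dist c p = rho].

Definition translation v : plane R -> plane R := fun p => p + v.

Definition rotation c (theta : R) : plane R -> plane R := fun p =>
  let w := p - c in
  c + (cos theta * w.1 - sin theta * w.2, sin theta * w.1 + cos theta * w.2).

(* Reflection across the line through a and b: twice the foot of the
   perpendicular from p, minus p. *)
Definition reflection a b : plane R -> plane R := fun p =>
  let foot := a + (dot (p - a) (b - a) / dot (b - a) (b - a)) *: (b - a) in
  2 *: foot - p.

(* The group generated by translations, rotations and reflections. *)
Inductive euclidean_motion : (plane R -> plane R) -> Prop :=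
| motion_translation v : euclidean_motion (translation v)
| motion_rotation c theta : euclidean_motion (rotation c theta)
| motion_reflection a b : a <> b -> euclidean_motion (reflection a b)
| motion_comp f g :
    euclidean_motion f -> euclidean_motion g -> euclidean_motion (f \o g)
| motion_inv f g :
    euclidean_motion f -> cancel f g -> cancel g f -> euclidean_motion g.

End Plane.

(* Four cyclically ordered points: indices live in the cyclic group 'I_4, so
   that i + 1 is the cyclic successor of i. *)
Notation vertices R := ('I_4 -> plane R).

Section Quadrilaterals.
Variable R : realType.
Implicit Types V W : vertices R.

Definition side V (i : 'I_4) : set (plane R) := segment (V i) (V (i + 1)).

Definition side_length V (i : 'I_4) : R := dist (V i) (V (i + 1)).

Definition has_sides V (l0 l1 l2 l3 : R) : Prop :=
  [/\ side_length V 0 = l0, side_length V 1 = l1,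
      side_length V 2 = l2 & side_length V 3 = l3].

Definition quadrilateral V : Prop :=
  (forall i j k : 'I_4, i != j -> j != k -> i != k ->
     ~ collinear (V i) (V j) (V k)) /\
  (forall i j : 'I_4, i != j ->
     open_segment (V i) (V (i + 1)) `&` open_segment (V j) (V (j + 1)) = set0).

Definition boundary V : set (plane R) := \bigcup_i side V i.

(* The closed region bounded by the Jordan curve [boundary V]: the curve
   together with the bounded components of its complement. *)
Definition region V : set (plane R) :=
  [set p | boundary V p \/ bounded_set (connected_component (~` boundary V) p)].

Definition area V : \bar R :=
  (@lebesgue_measure R \x @lebesgue_measure R)%E (region V).

Definition perimeter V : R := \sum_(i < 4) side_length V i.

Definition equable V : Prop := area V = (perimeter V)%:E.

Definition lattice V : Prop :=
  forall i, (V i).1 \is a Num.int /\ (V i).2 \is a Num.int.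

Definition LEQ V : Prop := [/\ quadrilateral V, lattice V & equable V].

Definition convex V : Prop :=
  convex_set (region V : set (convex_lmodType (R^o * R^o)%type)).

(* A circle is tangent to a side when its only common point with the line
   supporting the side is a point of the side. *)
Definition tangent_to_side V (i : 'I_4) (C : set (plane R)) : Prop :=
  exists2 p, side V i p & C `&` line (V i) (V (i + 1)) = [set p].

Definition tangential V : Prop :=
  exists c (rho : R), [/\ 0 < rho, circle c rho `<=` region V
    & forall i, tangent_to_side V i (circle c rho)].

Definition convex_tangential_LEQ V : Prop :=
  [/\ LEQ V, convex V & tangential V].

(* The starting vertex and the direction in which the vertices are listed are
   irrelevant to the quadrilateral, hence the relabellings by the dihedral
   group. *)
Definition congruent V W : Prop :=
  exists2 f : plane R -> plane R, euclidean_motion f &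
  exists k : 'I_4,
    (forall i, W (k + i) = f (V i)) \/ (forall i, W (k - i) = f (V i)).

Definition edge V (i : 'I_4) : plane R := V (i + 1) - V i.

Definition right_angle V (i : 'I_4) : Prop :=
  dot (V (i - 1) - V i) (V (i + 1) - V i) = 0.

Definition square V : Prop :=
  (forall i j, side_length V i = side_length V j) /\
  (forall i, right_angle V i).

(* The bases are the sides 1 and 3, the legs are the sides 0 and 2. *)
Definition trapezoid V : Prop :=
  parallel (edge V 1) (edge V 3) /\ ~ parallel (edge V 0) (edge V 2).

Definition isosceles_trapezoid V : Prop :=
  trapezoid V /\ side_length V 0 = side_length V 2.

Definition right_trapezoid V : Prop :=
  trapezoid V /\ exists i, right_angle V i.

Definition rhombus V : Prop :=
  forall i j, side_length V i = side_length V j.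

Definition kite V : Prop :=
  side_length V 0 = side_length V 1 /\ side_length V 2 = side_length V 3.

End Quadrilaterals.

(* Main.v *)
Require Import Defs.
From mathcomp Require Import all_boot all_order all_algebra.
From mathcomp Require Import all_classical all_reals all_analysis.
From mathcomp Require Import measurable_realfun ring lra zify.
Import Order.TTheory GRing.Theory Num.Theory numFieldNormedType.Exports.

(* A convex region forces the vertices into convex position (otherwise the
   midpoint of a diagonal escapes to infinity), so the quadrilateral is an
   intersection of half-planes, whose area is half the sum of two cross products.
   Summing the distances from the incentre to the sides, area = perimeter says
   that the inradius is 2.  If [t_i] are the lengths of the tangents from the
   vertices, the sides are [a_i = t_i + t_(i+1)], and Pitot's theorem together
   with the lattice condition makes them integers.  At each vertex, with incident
   sides [a], [a'] and interior angle [th], the numbers [n_i = a a' sin th] and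
   [m_i = a a' (1 - cos th)] are integers with [t_i = 2 n_i / m_i] and
   [m_i (t_i^2 + 4) = 8 a a'].  The law of cosines along a diagonal and Pitot's
   theorem give [m_0 = m_2 = m] and [m_1 = m_3 = m'], and
   [n_0 + n_2 = n_1 + n_3 = 4 (t_0 + t_1 + t_2 + t_3)] yields [1/m + 1/m' = 1/8].
   Hence [{m, m'}] is [{9, 72}], [{10, 40}], [{12, 24}] or [{16, 16}], and
   [m' n_0 n_2 + m n_1 n_3 = m m' (m + m')] leaves finitely many [t], which
   determine the quadrilateral up to motions. *)

Set Implicit Arguments.
Unset Strict Implicit.
Unset Printing Implicit Defensive.

(** * Diophantine part *)

(** The incentre bisects every angle, so tan (th / 2) = 2 / t, whence sin th = 4 t / (t^2 + 4) and 1
    - cos th = 8 / (t^2 + 4). This is the source of all relations between n, m, t and the sides,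
    which are then proved as identities between dot and cross products. The tangent lengths carry
    the whole argument because they are a complete invariant: the incentre and one vertex determine
    the next vertex from two consecutive tangent lengths, compatibly with rotations. Conversely,
    four positive numbers with the right dot and cross products force convexity, tangentiality and
    equability, so each example is certified by finitely many polynomial identities. *)

Lemma dvdn_sqr_residue d k n :
  all (fun r => (d %| r ^ 2) ==> (k %| r)) (iota 0 d) -> k %| d ->
  d %| n ^ 2 -> k %| n.
Proof.
have [->|d0] := posnP d; first by rewrite dvd0n expn_eq0 andbT => _ _ /eqP ->.
move=> /allP H kd dn; have := H (n %% d); rewrite mem_iota add0n ltn_pmod// => /(_ isT).
by rewrite /dvdn modnXm -/(dvdn _ _) dn/= (modn_dvdm _ kd).
Qed.

(** This is (x - 1) (z - 1) >= 0. Each search has one equation between products and one between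
    sums, and this inequality combines them into bounds on the variables. *)
Lemma leq_add_mul x z : 0 < x -> 0 < z -> x + z <= x * z + 1.
Proof. by case: x => // x; case: z => // z _ _; rewrite mulSn mulnS; lia. Qed.

(* The case [(m, m') = (9, 72)], with [n_0 = 3 x], [n_1 = 12 y], [n_2 = 3 z] and
   [n_3 = 12 w]. *)
Definition kite_solutions : seq (nat * nat * nat * nat) :=
  [:: (1, 1, 55, 13); (1, 13, 55, 1); (3, 3, 21, 3);
      (21, 3, 3, 3); (55, 1, 1, 13); (55, 13, 1, 1)].

(** The two divisibility conditions say that the sides a = (2 x + y) / 3 and b = (2 z + y) / 3 are
    integers. *)
Lemma kite_search x y z w : 0 < x -> 0 < y -> 0 < z -> 0 < w ->
  x * z + 2 * y * w = 81 -> x + z = 4 * (y + w) ->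
  3 %| 2 * x + y -> 3 %| 2 * z + y ->
  (x, y, z, w) \in kite_solutions.
Proof.
move=> x0 y0 z0 w0 xz S dx dz.
(* Since x z < 81, one of x and z is at most 8; the equations and the list of solutions are
   invariant under exchanging x and z. *)
wlog xz' : x z x0 z0 xz S dx dz / x <= 8.
  move=> H; have [|x8] := leqP x 8; first exact: H.
  have z8 : z <= 8.
    by rewrite leqNgt; apply/negP => z8; have := leq_mul x8 z8; lia.
  have := H z x z0 x0; rewrite (mulnC z) (addnC z) => /(_ xz S dz dx z8).
  rewrite !inE => /or4P[/eqP[-> -> -> ->]|/eqP[-> -> -> ->]|/eqP[-> -> -> ->]|].
  - by [].
  - by [].
  - by [].
  - by move=> /or3P[] /eqP[-> -> -> ->].
have xz1 : x + z <= x * z + 1 by exact: leq_add_mul.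
have yw1 : y + w <= y * w + 1 by exact: leq_add_mul.
(* The last two inequalities give 4 (y + w) <= 82 - 2 y w <= 84 - 2 (y + w), so y + w <= 14. *)
have y13 : y < 14 by lia.
have w13 : w < 14 by lia.
have zE : z = 4 * (y + w) - x by lia.
pose P x y w := let z := 4 * (y + w) - x in
  if x * z + 2 * y * w == 81 then
    (3 %| 2 * x + y) && (3 %| 2 * z + y) ==> ((x, y, z, w) \in kite_solutions)
  else true.
have /allP : all (fun x => all (fun y => all (fun w => P x y w) (iota 0 14)) (iota 0 14))
  (iota 0 9) by vm_compute.
move=> /(_ x); rewrite mem_iota => /(_ xz')/allP/(_ y).
rewrite mem_iota => /(_ y13)/allP/(_ w); rewrite mem_iota => /(_ w13).
by rewrite /P -zE xz eqxx dx dz.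
Qed.

(** The case (m, m') = (10, 40), with n_0 = 10 x, n_1 = 20 y, n_2 = 10 z and n_3 = 20 w. *)
Lemma rhombus_search x y z w : 0 < x -> 0 < y -> 0 < z -> 0 < w ->
  x * z + y * w = 5 -> x + z = 2 * (y + w) -> (x, y, z, w) = (2, 1, 2, 1).
Proof.
move=> x0 y0 z0 w0 xz S.
have xz1 := leq_add_mul x0 z0; have yw1 := leq_add_mul y0 w0.
have [y1 w1] : y = 1 /\ w = 1 by lia.
rewrite y1 w1 in xz S *; have x4 : x < 4 by lia.
have zE : z = 4 - x by lia.
by move: xz; rewrite zE; case: x x0 x4 {S xz1 zE} => [|[|[|[|//]]]].
Qed.

(** The case (m, m') = (12, 24), where each n_i is 12 times its variable. *)
Lemma right_trapezoid_search x y z w : 0 < x -> 0 < y -> 0 < z -> 0 < w ->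
  2 * (x * z) + y * w = 6 -> x + z = y + w ->
  (x, y, z, w) \in [:: (1, 1, 2, 2); (1, 2, 2, 1); (2, 1, 1, 2); (2, 2, 1, 1)].
Proof.
move=> x0 y0 z0 w0 xz S.
have xz1 := leq_add_mul x0 z0; have yw1 := leq_add_mul y0 w0.
have x4 : x <= 2 by lia.
have z4 : z <= 2 by lia.
have y4 : y <= 3 by lia.
have w4 : w <= 3 by lia.
case: x x0 x4 xz S {xz1} => [|[|[|//]]]// _ _; case: z z0 z4 => [|[|[|//]]]// _ _;
case: y y0 y4 {yw1} => [|[|[|[|//]]]]// _ _; by case: w w0 w4 => [|[|[|[|//]]]].
Qed.

(** The case (m, m') = (16, 16), where each n_i is 8 times its variable; it yields both the square
    and the isosceles trapezoid. *)
Lemma square_search x y z w : 0 < x -> 0 < y -> 0 < z -> 0 < w ->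
  x * z + y * w = 8 -> x + z = y + w ->
  (x, y, z, w) \in [:: (2, 2, 2, 2); (1, 1, 4, 4); (1, 4, 4, 1); (4, 1, 1, 4);
    (4, 4, 1, 1)].
Proof.
move=> x0 y0 z0 w0 xz S.
have xz1 := leq_add_mul x0 z0; have yw1 := leq_add_mul y0 w0.
have x4 : x <= 4 by lia.
have z4 : z <= 4 by lia.
have y4 : y <= 4 by lia.
have w4 : w <= 4 by lia.
case: x x0 x4 xz S {xz1} => [|[|[|[|[|//]]]]]// _ _;
  case: z z0 z4 => [|[|[|[|[|//]]]]]// _ _;
case: y y0 y4 {yw1} => [|[|[|[|[|//]]]]]// _ _; by case: w w0 w4 => [|[|[|[|[|//]]]]].
Qed.

(* The tuples [(m, m', n_0, n_1, n_2, n_3)] with [m <= m']. *)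
Definition tangent_solutions : seq (nat * nat * nat * nat * nat * nat) :=
  [:: (9, 72, 3, 12, 165, 156); (9, 72, 3, 156, 165, 12); (9, 72, 9, 36, 63, 36);
      (9, 72, 63, 36, 9, 36); (9, 72, 165, 12, 3, 156); (9, 72, 165, 156, 3, 12);
      (10, 40, 20, 20, 20, 20);
      (12, 24, 12, 12, 24, 24); (12, 24, 12, 24, 24, 12); (12, 24, 24, 12, 12, 24);
      (12, 24, 24, 24, 12, 12);
      (16, 16, 16, 16, 16, 16); (16, 16, 8, 8, 32, 32); (16, 16, 8, 32, 32, 8);
      (16, 16, 32, 8, 8, 32); (16, 16, 32, 32, 8, 8)].

(** The four equations with squares are sin^2 + (1 - cos)^2 = 2 (1 - cos), scaled by the square of
    the product of the two sides. The next two are a = t_0 + t_1 and b = t_1 + t_2 with denominators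
    cleared. *)
Lemma tangent_arith m m' n0 n1 n2 n3 a b c d :
  0 < n0 -> 0 < n1 -> 0 < n2 -> 0 < n3 -> 0 < m -> m <= m' ->
  n0 ^ 2 + m ^ 2 = 2 * m * (d * a) -> n1 ^ 2 + m' ^ 2 = 2 * m' * (a * b) ->
  n2 ^ 2 + m ^ 2 = 2 * m * (b * c) -> n3 ^ 2 + m' ^ 2 = 2 * m' * (c * d) ->
  m * m' * a = 2 * (m' * n0 + m * n1) -> m * m' * b = 2 * (m' * n2 + m * n1) ->
  n0 + n2 = n1 + n3 -> m * m' = 8 * (m + m') ->
  m' * (n0 * n2) + m * (n1 * n3) = m * m' * (m + m') ->
  (m, m', n0, n1, n2, n3) \in tangent_solutions.
Proof.
move=> n0p n1p n2p n3p m0 mm' E0 E1 E2 E3 Ea Eb S H P.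
(* Each equation with squares makes n^2 divisible by some d', and inspecting the residues modulo d'
   then gives k dividing n. For instance n_0^2 + 81 = 18 d a gives 9 | n_0^2, hence 3 | n_0. *)
have mdiv d' k n q u v : all (fun r => (d' %| r ^ 2) ==> (k %| r)) (iota 0 d') ->
  k %| d' ->
    n ^ 2 + d' * q = d' * u -> v = k -> exists n', n = v * n'.
  move=> Hr kd E ->; have : k %| n.
    apply: (@dvdn_sqr_residue d') => //.
    by rewrite -(dvdn_addl _ (dvdn_mulr q (dvdnn d'))) E dvdn_mulr.
  by move=> /dvdnP[n' ->]; exists n'; rewrite mulnC.
(* The relation [m * m' = 8 * (m + m')] reads (m - 8) (m' - 8) = 64, so m <= m' confines m to 9,
   ..., 16. *)
have m8 : 8 < m.
  rewrite ltnNge; apply/negP => m8; have : m * m' <= 8 * m' by rewrite leq_mul2r m8 orbT.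
  lia.
have m16 : m <= 16.
  rewrite leqNgt; apply/negP => m16; have : 17 * m' <= m * m'
    by rewrite leq_mul2r m16 orbT.
  lia.
have : m \in [:: 9; 10; 11; 12; 13; 14; 15; 16].
  by move: m m8 m16 {H P E0 E1 E2 E3 Ea Eb m0 mm'}; do 17! case=> //.
rewrite !inE => /or4P[/eqP mE|/eqP mE|/eqP mE|]; rewrite ?mE in E0 E1 E2 E3 Ea Eb H P *.
- have m'E : m' = 72 by move: H; clear; lia.
  rewrite m'E in E0 E1 E2 E3 Ea Eb H P *.
  have [|x xE] := @mdiv 9 3 n0 9 (2 * (d * a)) 3 isT isT _ erefl;
    first by clear -E0 E1 E2 E3; lia.
  have [|y yE] := @mdiv 144 12 n1 36 (a * b) 12 isT isT _ erefl;
    first by clear -E0 E1 E2 E3; lia.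
  have [|z zE] := @mdiv 9 3 n2 9 (2 * (b * c)) 3 isT isT _ erefl;
    first by clear -E0 E1 E2 E3; lia.
  have [|w wE] := @mdiv 144 12 n3 36 (c * d) 12 isT isT _ erefl;
    first by clear -E0 E1 E2 E3; lia.
  rewrite xE yE zE wE in n0p n1p n2p n3p S P Ea Eb *.
  have : (x, y, z, w) \in kite_solutions.
    by apply: kite_search; lia.
  rewrite !inE => /or4P[/eqP[-> -> -> ->]|/eqP[-> -> -> ->]|/eqP[-> -> -> ->]|]//.
  by move=> /or3P[] /eqP[-> -> -> ->].
- have m'E : m' = 40 by move: H; clear; lia.
  rewrite m'E in E0 E1 E2 E3 Ea Eb H P *.
  have [|x xE] := @mdiv 20 10 n0 5 (d * a) 10 isT isT _ erefl;
    first by clear -E0 E1 E2 E3; lia.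
  have [|y yE] := @mdiv 80 20 n1 20 (a * b) 20 isT isT _ erefl;
    first by clear -E0 E1 E2 E3; lia.
  have [|z zE] := @mdiv 20 10 n2 5 (b * c) 10 isT isT _ erefl;
    first by clear -E0 E1 E2 E3; lia.
  have [|w wE] := @mdiv 80 20 n3 20 (c * d) 20 isT isT _ erefl;
    first by clear -E0 E1 E2 E3; lia.
  rewrite xE yE zE wE in n0p n1p n2p n3p S P Ea Eb *.
  have [-> -> -> ->] : (x, y, z, w) = (2, 1, 2, 1) by apply: rhombus_search; lia.
  by [].
- by exfalso; move: H; clear; lia.
move=> /or4P[/eqP mE|/eqP mE|/eqP mE|]; last move=> /orP[] /eqP mE;
  rewrite ?mE in E0 E1 E2 E3 Ea Eb H P *.
- have m'E : m' = 24 by move: H; clear; lia.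
  rewrite m'E in E0 E1 E2 E3 Ea Eb H P *.
  have [|x xE] := @mdiv 24 12 n0 6 (d * a) 12 isT isT _ erefl;
    first by clear -E0 E1 E2 E3; lia.
  have [|y yE] := @mdiv 48 12 n1 12 (a * b) 12 isT isT _ erefl;
    first by clear -E0 E1 E2 E3; lia.
  have [|z zE] := @mdiv 24 12 n2 6 (b * c) 12 isT isT _ erefl;
    first by clear -E0 E1 E2 E3; lia.
  have [|w wE] := @mdiv 48 12 n3 12 (c * d) 12 isT isT _ erefl;
    first by clear -E0 E1 E2 E3; lia.
  rewrite xE yE zE wE in n0p n1p n2p n3p S P Ea Eb *.
  have : (x, y, z, w) \in [:: (1, 1, 2, 2); (1, 2, 2, 1); (2, 1, 1, 2); (2, 2, 1, 1)].
    by apply: right_trapezoid_search; lia.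
  by rewrite !inE => /or4P[] /eqP[-> -> -> ->].
- by exfalso; move: H; clear; lia.
- by exfalso; move: H; clear; lia.
- by exfalso; move: H; clear; lia.
have m'E : m' = 16 by move: H; clear; lia.
rewrite m'E in E0 E1 E2 E3 Ea Eb H P *.
have [|x xE] := @mdiv 32 8 n0 8 (d * a) 8 isT isT _ erefl; first by clear -E0 E1 E2 E3;
  lia.
have [|y yE] := @mdiv 32 8 n1 8 (a * b) 8 isT isT _ erefl; first by clear -E0 E1 E2 E3;
  lia.
have [|z zE] := @mdiv 32 8 n2 8 (b * c) 8 isT isT _ erefl; first by clear -E0 E1 E2 E3;
  lia.
have [|w wE] := @mdiv 32 8 n3 8 (c * d) 8 isT isT _ erefl; first by clear -E0 E1 E2 E3;
  lia.
rewrite xE yE zE wE in n0p n1p n2p n3p S P Ea Eb *.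
have : (x, y, z, w) \in [:: (2, 2, 2, 2); (1, 1, 4, 4); (1, 4, 4, 1); (4, 1, 1, 4);
  (4, 4, 1, 1)].
  by apply: square_search; lia.
rewrite !inE => /or4P[/eqP[-> -> -> ->]|/eqP[-> -> -> ->]|/eqP[-> -> -> ->]|]//.
by move=> /orP[] /eqP[-> -> -> ->].
Qed.

Local Open Scope classical_set_scope.
Local Open Scope ring_scope.

(** * Convex position and the region *)

Definition cross (R : realType) (u v : plane R) : R := u.1 * v.2 - u.2 * v.1.

(** Twice the signed area of the triangle on three consecutive vertices. In the counterclockwise
    case it is a a' sin th at the middle vertex [V (i + 1)], hence the integer n of that vertex. *)
Definition turn (R : realType) (V : vertices R) (i : 'I_4) : R :=
  cross (V (i + 1) - V i) (V (i + 2) - V i).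

(** The length of side [i] times the signed distance of [p] from its line, positive on the left. *)
Definition half_plane (R : realType) (V : vertices R) (i : 'I_4) (p : plane R) : R :=
  cross (V (i + 1) - V i) (p - V i).

Definition ccw (R : realType) (V : vertices R) : Prop := forall i, 0 < turn V i.

Lemma ord4_ind (P : 'I_4 -> Prop) : P 0 -> P 1 -> P 2 -> P 3 -> forall i, P i.
Proof.
move=> P0 P1 P2 P3 [[|[|[|[|//]]]] lti].
- by rewrite (_ : Ordinal lti = 0)//; apply: val_inj.
- by rewrite (_ : Ordinal lti = 1)//; apply: val_inj.
- by rewrite (_ : Ordinal lti = 2)//; apply: val_inj.
- by rewrite (_ : Ordinal lti = 3)//; apply: val_inj.
Qed.

Lemma ord4E : ((0 + 1 = 1 :> 'I_4)%R * (0 + 2 = 2 :> 'I_4)%R * (0 + 3 = 3 :> 'I_4)%R *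
  (0 + 0 = 0 :> 'I_4)%R * (1 + 1 = 2 :> 'I_4)%R * (1 + 2 = 3 :> 'I_4)%R *
  (1 + 3 = 0 :> 'I_4)%R * (1 + 0 = 1 :> 'I_4)%R * (2 + 1 = 3 :> 'I_4)%R *
  (2 + 2 = 0 :> 'I_4)%R * (2 + 3 = 1 :> 'I_4)%R * (2 + 0 = 2 :> 'I_4)%R *
  (3 + 1 = 0 :> 'I_4)%R * (3 + 2 = 1 :> 'I_4)%R * (3 + 3 = 2 :> 'I_4)%R *
  (3 + 0 = 3 :> 'I_4)%R * (- 0 = 0 :> 'I_4)%R * (- 1 = 3 :> 'I_4)%R *
  (- 2 = 2 :> 'I_4)%R * (- 3 = 1 :> 'I_4)%R)%type.
Proof. by do !split; apply: val_inj. Qed.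

Lemma sum4 (R : realType) (F : 'I_4 -> R) : \sum_(i < 4) F i = F 0 + F 1 + F 2 + F 3.
Proof.
rewrite !big_ord_recr big_ord0 /= add0r.
by congr (_ + _ + _ + _); congr F; apply: val_inj.
Qed.

Section Region.
Variable R : realType.
Implicit Types (V : vertices R) (p q a b c d : plane R).

Lemma planeE :
  ((forall p q, ((p + q).1 = p.1 + q.1)%R) * (forall p q, ((p + q).2 = p.2 + q.2)%R) *
   (forall p, ((- p).1 = - p.1)%R) * (forall p, ((- p).2 = - p.2)%R) *
   (forall (t : R) p, ((t *: p).1 = t * p.1)%R) *
   (forall (t : R) p, ((t *: p).2 = t * p.2)%R) *
   (forall x y : R, (x, y).1 = x) * (forall x y : R, (x, y).2 = y))%type.
Proof. by []. Qed.

Lemma half_plane_vertex V i :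
  [/\ half_plane V i (V i) = 0, half_plane V i (V (i + 1)) = 0,
      half_plane V i (V (i + 2)) = turn V i &
      half_plane V i (V (i + 3)) = turn V (i + 3)].
Proof.
by elim/ord4_ind: i; rewrite /half_plane /turn /cross !ord4E !planeE; split; ring.
Qed.

Lemma half_plane_segment V i p q (t : R) :
  half_plane V i ((1 - t) *: p + t *: q) =
  (1 - t) * half_plane V i p + t * half_plane V i q.
Proof. rewrite /half_plane /cross !planeE; ring. Qed.

Lemma ccw_vertex V i j : ccw V -> 0 <= half_plane V i (V j).
Proof.
move=> cV; rewrite -(subrK i j) addrC.
have [h0 h1 h2 h3] := half_plane_vertex V i.
by elim/ord4_ind: (j - i); rewrite ?addr0 ?h0 ?h1 ?h2 ?h3// ltW.
Qed.

Lemma boundaryP V p : boundary V p <-> exists i (t : R),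
  [/\ 0 <= t, t <= 1 & p = (1 - t) *: V i + t *: V (i + 1)].
Proof.
split=> [[i _ [t /=]]|[i [t [t0 t1 ->]]]].
  by rewrite in_itv/= => /andP[t0 t1] <-; exists i, t.
by exists i => //; exists t => //=; rewrite in_itv/= t0 t1.
Qed.

Lemma ccw_boundary V i p : ccw V -> boundary V p -> 0 <= half_plane V i p.
Proof.
move=> cV /boundaryP[j [t [t0 t1 ->]]].
rewrite half_plane_segment addr_ge0// mulr_ge0// ?ccw_vertex//.
by rewrite subr_ge0.
Qed.

(** Along the line [ab], the signed distance to the line [da] is affine, zero at [a] and positive at
    [b]; its ratio to the value at [b] is the parameter [t], so t >= 0. The line [bc] gives t <= 1
    in the same way. *)
Lemma segment_between a b c d p :
  cross (b - a) (p - a) = 0 ->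
  0 <= cross (a - d) (p - d) -> 0 < cross (a - d) (b - d) ->
  0 <= cross (c - b) (p - b) -> 0 < cross (c - b) (a - b) ->
  segment a b p.
Proof.
move=> p0 pd bd pb ab.
pose t := cross (a - d) (p - d) / cross (a - d) (b - d).
have Hp : p = (1 - t) *: a + t *: b.
  have bd0 : cross (a - d) (b - d) != 0 by rewrite gt_eqF.
  have e1 : p.1 * cross (a - d) (b - d) = a.1 * cross (a - d) (b - d) +
    (b.1 - a.1) * cross (a - d) (p - d) - (a.1 - d.1) * cross (b - a) (p - a).
    by rewrite /cross !planeE; ring.
  have e2 : p.2 * cross (a - d) (b - d) = a.2 * cross (a - d) (b - d) +
    (b.2 - a.2) * cross (a - d) (p - d) - (a.2 - d.2) * cross (b - a) (p - a).
    by rewrite /cross !planeE; ring.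
  rewrite [p]surjective_pairing [RHS]surjective_pairing; congr pair; apply: (mulIf bd0).
  - rewrite e1 p0 /t; set u := cross _ _ in bd0 *; set v := cross _ _; rewrite !planeE;
    field.
    exact: bd0.
  - rewrite e2 p0 /t; set u := cross _ _ in bd0 *; set v := cross _ _; rewrite !planeE;
    field.
    exact: bd0.
have t1 : cross (c - b) (p - b) = (1 - t) * cross (c - b) (a - b).
  by rewrite Hp /cross !planeE; ring.
exists t => //=; rewrite in_itv/= divr_ge0 ?(ltW bd)//=.
by move: pb; rewrite t1 pmulr_lge0// subr_ge0.
Qed.

Lemma ccw_side V i p : ccw V -> (forall j, 0 <= half_plane V j p) ->
  half_plane V i p = 0 -> boundary V p.
Proof.
move=> cV Hp H0; exists i => //.
apply: (@segment_between _ _ (V (i + 2)) (V (i + 3))) => //.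
- by have := Hp (i + 3); rewrite /half_plane -addrA ord4E addr0.
- by have := cV (i + 3); rewrite /turn -!addrA !ord4E addr0.
- by have := Hp (i + 1); rewrite /half_plane -addrA ord4E.
- have [_ _ _] := half_plane_vertex V (i + 1).
  by rewrite /half_plane -!addrA !ord4E addr0 => ->; exact: cV.
Qed.

(** The triangles joining [p] to the sides have a signed total area that does not depend on [p].
    This bounds the intersection of the half-planes, and at the incentre it relates area, inradius
    and perimeter. *)
Lemma half_plane_sum V p : \sum_i half_plane V i p = turn V 0 + turn V 2.
Proof. rewrite sum4 /half_plane /turn /cross !ord4E !planeE; ring. Qed.

Lemma continuous_affine (k l m : R) :
  continuous (fun p : plane R => k * p.1 + l * p.2 + m).
Proof.
move=> p; apply: cvgD; last exact: cvg_cst.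
by apply: cvgD; apply: cvgM; [exact: cvg_cst|exact: cvg_fst|exact: cvg_cst|exact:
  cvg_snd].
Qed.

Lemma continuous_half_plane V i : continuous (half_plane V i).
Proof.
have -> : half_plane V i = (fun p : plane R =>
   (- (V (i + 1) - V i).2) * p.1 + (V (i + 1) - V i).1 * p.2 +
   - cross (V (i + 1) - V i) (V i)).
  by apply/funext => p; rewrite /half_plane /cross !planeE; ring.
exact: continuous_affine.
Qed.

(** Nonnegative terms with a constant sum are bounded, and the half-plane functions of sides 3 and 0
    are, up to the factor [turn V 3], the coordinates of [p - V 0] in the basis [V 1 - V 0],
    [V 3 - V 0]. *)
Lemma bounded_half_planes V : ccw V ->
  bounded_set [set p | forall i, 0 <= half_plane V i p].
Proof.
move=> cV.
pose S := turn V 0 + turn V 2.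
have hS p i : (forall i, 0 <= half_plane V i p) -> half_plane V i p <= S.
  move=> Hp; rewrite /S -(half_plane_sum V p) (bigD1 i)//= lerDl.
  exact: sumr_ge0.
pose B := S * (`|V 1 - V 0| + `|V 3 - V 0|) / turn V 3 + `|V 0|.
exists B; split; first exact: num_real.
move=> M BM p /= Hp; apply: le_trans (ltW BM).
have T0 : turn V 3 != 0 by rewrite gt_eqF ?cV.
have -> : p = (half_plane V 3 p / turn V 3) *: (V 1 - V 0) +
   (half_plane V 0 p / turn V 3) *: (V 3 - V 0) + V 0.
  have e1 : p.1 * turn V 3 = half_plane V 3 p * (V 1 - V 0).1 +
    half_plane V 0 p * (V 3 - V 0).1 + (V 0).1 * turn V 3.
    by rewrite /half_plane /turn /cross !ord4E !planeE; ring.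
  have e2 : p.2 * turn V 3 = half_plane V 3 p * (V 1 - V 0).2 +
    half_plane V 0 p * (V 3 - V 0).2 + (V 0).2 * turn V 3.
    by rewrite /half_plane /turn /cross !ord4E !planeE; ring.
  rewrite [LHS]surjective_pairing [RHS]surjective_pairing; congr pair; apply: (mulIf T0).
  - by rewrite e1; set t := turn V 3 in T0 *; set h := half_plane V 3 p;
    set h' := half_plane V 0 p; rewrite !planeE; field.
  - by rewrite e2; set t := turn V 3 in T0 *; set h := half_plane V 3 p;
    set h' := half_plane V 0 p; rewrite !planeE; field.
apply: le_trans (ler_normD _ _) _; rewrite lerD2r.
apply: le_trans (ler_normD _ _) _; rewrite !normrZ.
rewrite !ger0_norm ?mulr_ge0 ?invr_ge0 ?(ltW (cV _))//.
by rewrite mulrDr mulrDl; apply: lerD; rewrite mulrAC;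
   rewrite ler_wpM2r ?invr_ge0 ?(ltW (cV _))// ler_wpM2r// hS.
Qed.

Lemma not_bounded_ray (A : set (plane R)) p v : v != 0 ->
  (forall s, 0 <= s -> A (p + s *: v)) -> ~ bounded_set A.
Proof.
move=> v0 Av [M [_ /(_ (M + 1))]]; rewrite ltrDl ltr01 => /(_ isT) HM.
have v_gt0 : 0 < `|v| by rewrite normr_gt0.
pose s := (`|M| + 2 + `|p|) / `|v|.
have s0 : 0 <= s by rewrite divr_ge0// addr_ge0// addr_ge0.
have : `|p + s *: v| <= M + 1 := HM _ (Av s s0).
rewrite leNgt => /negP; apply.
have : `|s *: v| <= `|p + s *: v| + `|p|.
  by rewrite -[in leLHS](addKr p (s *: v)) addrC (le_trans (ler_normB _ _)).
rewrite normrZ ger0_norm// divfK ?gt_eqF// lerD2r.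
by apply: lt_le_trans; apply: ler_ltD; [exact: ler_norm|rewrite ltr1n].
Qed.

Lemma connected_ray p v : connected [set p + s *: v | s in [set s : R | 0 <= s]].
Proof.
apply: connected_continuous_connected.
  by apply/connected_intervalP => x y /= x0 y0 z /andP[xz _]; apply: le_trans xz.
apply: continuous_subspaceT => s; apply: cvgD; first exact: cvg_cst.
by apply: cvgZr_tmp; exact: cvg_id.
Qed.

(** A ray avoiding the boundary is connected, so it lies in the component of its origin, which is
    then unbounded. *)
Lemma ray_not_region V p v : v != 0 ->
  (forall s, 0 <= s -> ~ boundary V (p + s *: v)) -> ~ region V p.
Proof.
move=> v0 Hs [|].
  by have := Hs 0; rewrite scale0r addr0 lexx => /(_ isT).
apply: (not_bounded_ray v0) => s s0.
apply: (@connected_component_max _ _ [set p + s *: v | s in [set s : R | 0 <= s]]).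
- by exists 0 => //=; rewrite scale0r addr0.
- by move=> _ [r /= r0 <-]; exact: Hs.
- exact: connected_ray.
- by exists s.
Qed.

Lemma perp_neq0 (v w : plane R) : cross v w != 0 -> ((v.2, - v.1) : plane R) != 0.
Proof.
case: v => x y; apply: contraNneq => -[/= -> /eqP].
by rewrite oppr_eq0 => /eqP ->; rewrite /cross/= !mul0r subrr.
Qed.

(** A point violating the inequality of side [i] escapes along the outward normal of that side,
    since the boundary satisfies the inequality. *)
Lemma region_ccw V : ccw V ->
  region V = [set p | forall i, 0 <= half_plane V i p].
Proof.
move=> cV; apply/seteqP; split=> p /=.
  apply: contraPP => /existsNP[i /negP]; rewrite -ltNge => Hi.
  pose e := V (i + 1) - V i.
  apply: (@ray_not_region _ _ (e.2, - e.1)).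
    by apply: perp_neq0; rewrite gt_eqF//; exact: cV.
  move=> s s0 /(ccw_boundary i cV); rewrite leNgt => /negP; apply.
  have -> : half_plane V i (p + s *: (e.2, - e.1)) =
    half_plane V i p - s * (e.1 ^+ 2 + e.2 ^+ 2).
    by rewrite /half_plane /e /cross !planeE; ring.
  by rewrite ltrBlDr ltr_wpDr// mulr_ge0// addr_ge0// sqr_ge0.
move=> Hp; have [Bp|nBp] := pselect (boundary V p); first by left.
right; pose C := connected_component (~` boundary V) p.
have CB q : C q -> ~ boundary V q by exact: connected_component_sub.
have Cp : C p by exact: connected_component_refl.
(* Off the boundary the inequalities can only hold strictly, so the intersection is both open and
   closed in the connected set [C]; it is then all of [C], and bounded. *)
suff CE : C = C `&` [set q | forall i, 0 <= half_plane V i q].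
  rewrite -/C CE; have [M [Mr HM]] := bounded_half_planes cV.
  by exists M; split => // N MN q /= [_ Hq]; exact: (HM N MN q).
symmetry; apply: component_connected.
- by exists p.
- pose O i := half_plane V i @^-1` [set r | 0 < r].
  have Oo i : open (O i).
    by apply: open_comp; [move=> q _; exact: continuous_half_plane|exact: open_gt].
  exists (O 0 `&` O 1 `&` O 2 `&` O 3); first by do 3 apply: openI => //.
  apply/seteqP; split=> q [Cq Hq]; split=> //; last first.
    case: Hq => -[[H0 H1] H2] H3 i.
    by elim/ord4_ind: i; exact: ltW.
  have {}Hq i : O i q.
    rewrite /O/= lt_neqAle Hq andbT; apply/eqP => /esym H0.
    exact: CB Cq (ccw_side cV Hq H0).
  by split=> //; split=> //; split.
- exists (\bigcap_(i in [set: 'I_4]) (half_plane V i @^-1` [set r | 0 <= r])).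
    apply: closed_bigI => i _.
    by apply: closed_comp; [move=> q _; exact: continuous_half_plane|exact: closed_ge].
  by apply/seteqP; split=> q /= [Cq Hq]; split=> // i; [move=> _|]; exact: Hq.
Qed.

End Region.

(** * Convexity of the region forces convex position; reversal of the vertex order *)

Section Convex.
Variable R : realType.
Implicit Types (V : vertices R) (p q a b c d : plane R).

Lemma boundary_vertex V i : boundary V (V i).
Proof. by apply/boundaryP; exists i, 0; rewrite subr0 scale1r scale0r addr0. Qed.

Lemma convex_midpoint V a b : convex V -> region V a -> region V b ->
  region V (2^-1 *: a + 2^-1 *: b).
Proof.
move=> cV ra rb.
have h0 : 0 <= 2^-1 :> R by rewrite invr_ge0.
have h1 : 2^-1 <= 1 :> R by rewrite invf_le1// ler1n.
have := cV a b (Itv01 h0 h1); rewrite !inE => /(_ ra rb).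
suff -> : conv (Itv01 h0 h1) (a : convex_lmodType (R^o * R^o)%type) b =
    2^-1 *: a + 2^-1 *: b by [].
have e : 1 - 2^-1 = 2^-1 :> R by lra.
by congr (_ + _ *: _); exact: e.
Qed.

(** On a side [g] interpolates two nonnegative values that are never both zero, so it can vanish
    only at an endpoint. *)
Lemma side_nonneg V (g : plane R -> R) p :
  (forall p q (t : R), g ((1 - t) *: p + t *: q) = (1 - t) * g p + t * g q) ->
  (forall j, 0 <= g (V j)) ->
  (forall j, g (V j) = 0 -> 0 < g (V (j + 1)) /\ 0 < g (V (j - 1))) ->
  boundary V p -> 0 <= g p /\ (g p = 0 -> exists2 j, p = V j & g (V j) = 0).
Proof.
move=> gE g0 gV /boundaryP[j [t [t0 t1 ->]]]; rewrite gE.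
have {}t1 : 0 <= 1 - t by rewrite subr_ge0.
split=> [|/eqP]; first by rewrite addr_ge0// mulr_ge0.
rewrite paddr_eq0 ?mulr_ge0// !mulf_eq0 => /andP[/orP[/eqP s0|/eqP gj] /orP[/eqP z0|/eqP
  gj1]].
- lra.
- by exists (j + 1) => //; rewrite s0 scale0r add0r (_ : t = 1) ?scale1r//; apply/eqP;
  rewrite eq_sym -subr_eq0 s0.
- by exists j => //; rewrite z0 scale0r addr0 subr0 scale1r.
- by have [] := gV _ gj; rewrite gj1 ltxx.
Qed.

(** With opposite signs, [V i] and [V (i + 2)] would lie strictly on the same side of the diagonal
    joining [V (i + 1)] and [V (i + 3)]. The boundary would then meet the line of this diagonal only
    at its ends, and a ray from the midpoint towards the other side would avoid the boundary. *)
Lemma convex_diagonal V i : convex V -> turn V (i + 1) != 0 ->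
  turn V (i + 3) != 0 -> 0 < turn V (i + 1) * turn V (i + 3).
Proof.
move=> cV t1 t3; rewrite ltNge; apply/negP => t13.
have {}t13 : turn V (i + 1) * turn V (i + 3) < 0.
  by rewrite lt_neqAle t13 mulf_neq0.
pose a := V (i + 1); pose b := V (i + 3).
(* The factor [turn V (i + 3)] makes [g] positive at [V i] whatever the orientation; the same factor
   in [v] below makes [g] decrease along the ray. *)
pose g p := turn V (i + 3) * cross (b - a) (p - a).
have gE p q t : g ((1 - t) *: p + t *: q) = (1 - t) * g p + t * g q.
  by rewrite /g /cross !planeE; ring.
have ga : g (V (i + 1)) = 0 by rewrite /g /cross /a !planeE; ring.
have gb : g (V (i + 3)) = 0 by rewrite /g /cross /b !planeE; ring.
have gi : 0 < g (V i).
  suff -> : g (V i) = turn V (i + 3) ^+ 2 by rewrite exprn_even_gt0.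
  rewrite /g /a /b /turn -!addrA !ord4E addr0 /cross !planeE; ring.
have gi2 : 0 < g (V (i + 2)).
  suff -> : g (V (i + 2)) = - (turn V (i + 1) * turn V (i + 3)) by rewrite oppr_gt0.
  rewrite /g /a /b /turn -!addrA !ord4E addr0 /cross !planeE; ring.
have gp p : boundary V p -> 0 <= g p /\ (g p = 0 -> p = a \/ p = b).
  move=> Bp; have [||p0 p1] := @side_nonneg V g p gE _ _ Bp.
  - move=> j; rewrite -(subrK i j) addrC.
    by elim/ord4_ind: (j - i); rewrite ?addr0 ?ga ?gb// ltW.
  - move=> j; rewrite -(subrK i j) addrC.
    elim/ord4_ind: (j - i); rewrite ?addr0 -?addrA !ord4E ?addr0 ?gi ?gi2//.
    + by move=> g0; move: gi; rewrite g0 ltxx.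
    + by move=> g0; move: gi2; rewrite g0 ltxx.
  split=> // /p1[j ->]; rewrite -(subrK i j) addrC.
  elim/ord4_ind: (j - i); rewrite ?addr0 ?ga ?gb//; [|by left| |by right].
  - by move=> g0; move: gi; rewrite g0 ltxx.
  - by move=> g0; move: gi2; rewrite g0 ltxx.
have rab := convex_midpoint cV (or_introl (boundary_vertex V (i + 1)))
              (or_introl (boundary_vertex V (i + 3))).
have ba0 : b - a != 0.
  apply: contraTneq gi => e0.
  by rewrite /g e0 /cross !planeE !mul0r subrr mulr0 ltxx.
pose v := turn V (i + 3) *: ((b - a).2, - (b - a).1) : plane R.
have v0 : v != 0.
  rewrite /v scaler_eq0 negb_or t3/=.
  apply: (@perp_neq0 _ (b - a) (V i - a)).
  by apply: contraTneq gi => e0; rewrite /g e0 mulr0 ltxx.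
apply: (ray_not_region v0 _ rab) => s s0 /gp[].
have -> : g (2^-1 *: a + 2^-1 *: b + s *: v) =
  - (s * (turn V (i + 3) ^+ 2 * ((b - a).1 ^+ 2 + (b - a).2 ^+ 2))).
  by rewrite /g /v /cross !planeE; field.
have N0 : 0 < turn V (i + 3) ^+ 2 * ((b - a).1 ^+ 2 + (b - a).2 ^+ 2).
  apply: mulr_gt0; first by rewrite exprn_even_gt0.
  rewrite lt_neqAle addr_ge0 ?sqr_ge0// andbT eq_sym paddr_eq0 ?sqr_ge0// !sqrf_eq0.
  by apply: contra ba0 => /andP[/eqP e1 /eqP e2]; apply/eqP;
    rewrite [LHS]surjective_pairing e1 e2.
rewrite oppr_ge0 pmulr_lle0// => s1; have {s0 s1} -> : s = 0 by apply/eqP;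
  rewrite eq_le s0 s1.
rewrite mul0r oppr0 scale0r addr0 => /(_ erefl) H.
suff : b - a = 0 by move/eqP; rewrite (negbTE ba0).
case: H => H.
- have -> : b - a = 2 *: ((2^-1 *: a + 2^-1 *: b) - a).
    by apply/eqP; rewrite -subr_eq0; apply/eqP; rewrite [LHS]surjective_pairing !planeE;
      congr pair; field.
  by rewrite H subrr scaler0.
- have -> : b - a = 2 *: (b - (2^-1 *: a + 2^-1 *: b)).
    by apply/eqP; rewrite -subr_eq0; apply/eqP; rewrite [LHS]surjective_pairing !planeE;
      congr pair; field.
  by rewrite H subrr scaler0.
Qed.

(** Both sides are twice the signed area, cut along one diagonal or the other. *)
Lemma turn_sum V : turn V 0 + turn V 2 = turn V 1 + turn V 3.
Proof. rewrite /turn /cross !ord4E !planeE; ring. Qed.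

Lemma line_refl a b : line a b a.
Proof. by exists 0 => //; rewrite subr0 scale1r scale0r addr0. Qed.

Lemma quadrilateral_turn V i : quadrilateral V -> turn V i != 0.
Proof.
move=> [/(_ i (i + 1) (i + 2)) ncol _]; apply/eqP => t0; apply: ncol.
- by rewrite -subr_eq0 opprD addrA subrr add0r -[- 1]add0r ord4E.
- by rewrite -subr_eq0 opprD addrA (addrAC i) subrr add0r; elim/ord4_ind: i {t0}.
- by rewrite -subr_eq0 opprD addrA subrr add0r ord4E.
have [e0|e0] := eqVneq (V (i + 1)) (V i).
  have [f0|f0] := eqVneq (V (i + 2)) (V i).
    (* When the three vertices coincide, any second point provides the line that [collinear] asks
       for. *)
    exists (V i), (V i + (1, 0)); rewrite e0 f0; split; try exact: line_refl.
    move/(congr1 fst); rewrite planeE/= => /eqP.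
    by rewrite -subr_eq0 opprD addrA subrr sub0r oppr_eq0 oner_eq0.
  exists (V i), (V (i + 2)); rewrite e0; split; try exact: line_refl.
    by apply/eqP; rewrite eq_sym.
  by exists 1 => //; rewrite subrr scale0r add0r scale1r.
exists (V i), (V (i + 1)); split; try exact: line_refl.
- by apply/eqP; rewrite eq_sym.
- by exists 1 => //; rewrite subrr scale0r add0r scale1r.
have [u uE] : exists u, u = V (i + 1) - V i by exists (V (i + 1) - V i).
have [w wE] : exists w, w = V (i + 2) - V i by exists (V (i + 2) - V i).
pose n := u.1 ^+ 2 + u.2 ^+ 2.
have n0 : n != 0.
  rewrite paddr_eq0 ?sqr_ge0// !sqrf_eq0; apply: contra e0 => /andP[/eqP e1 /eqP e2].
  by rewrite -subr_eq0 -uE [u]surjective_pairing e1 e2.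
exists (dot u w / n) => //.
have H1 : w.1 * n = u.1 * dot u w - u.2 * turn V i.
  by rewrite /turn -uE -wE /cross /dot /n; ring.
have H2 : w.2 * n = u.2 * dot u w + u.1 * turn V i.
  by rewrite /turn -uE -wE /cross /dot /n; ring.
have -> : V (i + 2) = w + V i by rewrite wE subrK.
have -> : V (i + 1) = u + V i by rewrite uE subrK.
move: H1 H2; rewrite t0 !mulr0 subr0 addr0 => H1 H2.
rewrite [LHS]surjective_pairing [RHS]surjective_pairing; congr pair; rewrite !planeE.
- have -> : w.1 = u.1 * (dot u w / n) by rewrite mulrA -H1 mulfK.
  ring.
- have -> : w.2 = u.2 * (dot u w / n) by rewrite mulrA -H2 mulfK.
  ring.
Qed.

Definition rev V : vertices R := fun i => V (- i).

Lemma turn_rev V i : turn (rev V) i = - turn V (- i - 2).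
Proof.
rewrite /turn /rev !(opprD i) subrK.
have -> : - i - 2 + 1 = - i - 1 by rewrite -addrA; congr (_ + _); apply: val_inj.
rewrite /cross !planeE; ring.
Qed.

(** Opposite turns have the same sign by [convex_diagonal], and [turn_sum] forbids the two pairs
    from having different signs. *)
Lemma convex_ccw V : quadrilateral V -> convex V -> ccw V \/ ccw (rev V).
Proof.
move=> /quadrilateral_turn tV cV.
have := @convex_diagonal V 0 cV (tV _) (tV _).
have := @convex_diagonal V 1 cV (tV _) (tV _).
rewrite !ord4E => p02 p13; have S := turn_sum V.
have [t0|t0] := ltP 0 (turn V 0).
  left; have t2 : 0 < turn V 2 by rewrite -(pmulr_lgt0 _ t0).
  have t1 : 0 < turn V 1.
    rewrite ltNge; apply/negP => t1; have t3 : turn V 3 < 0.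
      by rewrite ltNge; apply/negP => t3; move: p13; rewrite ltNge mulr_le0_ge0.
    lra.
  have t3 : 0 < turn V 3 by rewrite -(pmulr_rgt0 _ t1).
  by elim/ord4_ind.
right; have {}t0 : turn V 0 < 0 by rewrite lt_neqAle tV.
have t2 : turn V 2 < 0 by rewrite -(nmulr_lgt0 _ t0).
have t1 : turn V 1 < 0.
  rewrite ltNge; apply/negP => t1; have t3 : 0 < turn V 3.
    by rewrite ltNge; apply/negP => t3; move: p13; rewrite ltNge mulr_ge0_le0.
  lra.
have t3 : turn V 3 < 0 by rewrite -(nmulr_rgt0 _ t1).
by move=> i; rewrite turn_rev oppr_gt0; elim/ord4_ind: (- i - 2).
Qed.

Lemma comb_swap p q (t : R) : (1 - t) *: p + t *: q = (1 - (1 - t)) *: q + (1 - t) *: p.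
Proof. by rewrite subKr addrC. Qed.

Lemma segmentC p q : segment p q = segment q p.
Proof.
apply/seteqP; split=> x [t /=]; rewrite in_itv/= => /andP[t0 t1] <-;
  by exists (1 - t); rewrite -?comb_swap//= in_itv/=; apply/andP; split; lra.
Qed.

Lemma open_segmentC p q : open_segment p q = open_segment q p.
Proof.
apply/seteqP; split=> x [t /=]; rewrite in_itv/= => /andP[t0 t1] <-;
  by exists (1 - t); rewrite -?comb_swap//= in_itv/=; apply/andP; split; lra.
Qed.

Lemma lineC p q : line p q = line q p.
Proof.
by apply/seteqP; split=> _ [t _ <-]; exists (1 - t); rewrite -?comb_swap.
Qed.

Lemma distC p q : dist p q = dist q p.
Proof. by rewrite /dist /dot !planeE; congr Num.sqrt; ring. Qed.

Lemma side_rev V i : side (rev V) i = side V (- i - 1).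
Proof. by rewrite /side /rev subrK (opprD i) segmentC. Qed.

Lemma boundary_rev V : boundary (rev V) = boundary V.
Proof.
apply/seteqP; split=> p [i _]; rewrite ?side_rev => Hi.
  by exists (- i - 1).
by exists (- i - 1) => //; rewrite side_rev opprB opprK addrAC subrr add0r.
Qed.

Lemma region_rev V : region (rev V) = region V.
Proof. by rewrite /region boundary_rev. Qed.

Lemma perimeter_rev V : perimeter (rev V) = perimeter V.
Proof.
rewrite /perimeter !sum4 /side_length /rev !ord4E.
rewrite (distC (V 0) (V 3)) (distC (V 3) (V 2)) (distC (V 2) (V 1)) (distC (V 1) (V 0)).
ring.
Qed.

Lemma convex_tangential_LEQ_rev V :
  convex_tangential_LEQ V -> convex_tangential_LEQ (rev V).
Proof.
move=> [[[ncol disj] latV eqV] cV [c [rho [rho0 circ tang]]]]; split.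
- split.
  + split=> [i j k ij jk ik|i j ij].
      by apply: ncol; rewrite eqr_opp.
    rewrite /rev !opprD ![open_segment (V (- _)) _]open_segmentC.
    have := disj (- i - 1) (- j - 1); rewrite !subrK; apply.
    by rewrite (inj_eq (addIr _)) eqr_opp.
  + by move=> i; exact: latV.
  + by rewrite /equable /area region_rev perimeter_rev.
- by rewrite /convex region_rev.
- exists c, rho; split=> //; first by rewrite region_rev.
  move=> i; have [p sp Cp] := tang (- i - 1); exists p; first by rewrite side_rev.
  by move: Cp; rewrite subrK /rev (opprD i) lineC.
Qed.

Lemma congruent_rev V W : congruent (rev V) W -> congruent V W.
Proof.
move=> [f mf [k [H|H]]]; exists f => //; exists k; [right|left] => i.
- by rewrite H /rev opprK.
- by rewrite -[i in LHS]opprK H /rev opprK.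
Qed.

End Convex.

(** * Area *)

Section Area.
Variable R : realType.
Implicit Types (V : vertices R) (p q a b c d u v w : plane R).
Let mu := @lebesgue_measure R.
Let mu2 := (@lebesgue_measure R \x @lebesgue_measure R)%E.

Lemma integral_affine (k z a b : R) : a <= b ->
  (\int[mu]_(x in `[a, b]) (k * (x - z))%:E =
   ((b - a) * (k * (a - z) + k * (b - z)) / 2)%:E)%E.
Proof.
rewrite le_eqVlt => /predU1P[<-|ab].
  by rewrite set_itv1 integral_set1 subrr !mul0r.
have cf : continuous (fun x : R => k * (x - z)).
  move=> x; apply: cvgM; first exact: cvg_cst.
  by apply: cvgB; [exact: cvg_id|exact: cvg_cst].
have dF (x : R) : is_derive x (1 : R) (fun x : R => k / 2 * (x - z) ^+ 2) (k * (x - z)).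
  apply: is_derive_eq.
  by rewrite /GRing.scale/=; field.
have cF : continuous (fun x : R => k / 2 * (x - z) ^+ 2).
  move=> x; apply: differentiable_continuous; apply/derivable1_diffP.
  exact: (@ex_derive _ _ _ _ _ _ _ (dF x)).
rewrite (@continuous_FTC2 _ _ (fun x => k / 2 * (x - z) ^+ 2))//.
- by rewrite -EFinB; congr (_%:E); field.
- exact: continuous_subspaceT.
- split.
  + by move=> x _; exact: (@ex_derive _ _ _ _ _ _ _ (dF x)).
  + exact/cvg_at_right_filter/cF.
  + exact/cvg_at_left_filter/cF.
- by move=> x _; rewrite derive1E; exact: (@derive_val _ _ _ _ _ _ _ (dF x)).
Qed.

(** The product measure is the integral of the section lengths. The sections at the two ends are
    left free because single points do not affect the integral. *)
Lemma strip_area (E : set (plane R)) (k z a b : R) : a <= b ->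
  (forall p, E p -> a <= p.1 <= b) ->
  (forall x, a < x < b -> mu (xsection E x) = (k * (x - z))%:E) ->
  mu2 E = ((b - a) * (k * (a - z) + k * (b - z)) / 2)%:E.
Proof.
move=> ab Eab HE; rewrite -integral_affine// /mu2 /product_measure1.
have mk : measurable_fun [set: R] ((fun x : R => (k * (x - z))%:E) : R -> \bar R).
  apply/measurable_EFinP; apply: continuous_measurable_fun => x.
  apply: cvgM; first exact: cvg_cst.
  by apply: cvgB; [exact: cvg_id|exact: cvg_cst].
transitivity (\int[mu]_(x in `[a, b]) (mu \o xsection E) x)%E.
  rewrite [RHS]integral_mkcond; apply: eq_integral => x _.
  rewrite patchE; case: ifPn => //; rewrite notin_setE/= in_itv/= => /negP nx.
  rewrite (_ : xsection E x = set0) ?measure0//.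
  apply/seteqP; split=> // y; rewrite /xsection/= inE => /Eab/=.
  by move=> xab; rewrite xab in nx.
rewrite integral_itv_bndoo; last first.
  apply: eq_measurable_fun (measurable_funTS mk) => x.
  by rewrite inE/= in_itv/= => /HE.
rewrite [RHS]integral_itv_bndoo; last exact: measurable_funTS.
by apply: eq_integral => x; rewrite inE/= in_itv/= => /HE.
Qed.

(** Both directions point to the right; the sign condition covers the wedge to the right of its apex
    as well as, with [v] and [w] in the opposite order, the one to its left. *)
Lemma wedge_section v w p (x : R) : 0 < v.1 -> 0 < w.1 ->
  0 <= cross v w * (x - p.1) ->
  mu [set y | 0 <= cross v ((x, y) - p) /\ 0 <= cross ((x, y) - p) w] =
  (cross v w / (v.1 * w.1) * (x - p.1))%:E.
Proof.
move=> v0 w0 vw.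
have -> : [set y | 0 <= cross v ((x, y) - p) /\ 0 <= cross ((x, y) - p) w] =
  `[p.2 + v.2 / v.1 * (x - p.1), p.2 + w.2 / w.1 * (x - p.1)]%classic.
  apply/seteqP; split=> y /=; rewrite in_itv/=.
    move=> [Hv Hw]; apply/andP; split.
    - rewrite -subr_ge0 -(pmulr_rge0 _ v0); congr (0 <= _): Hv.
      by rewrite /cross !planeE; field; rewrite gt_eqF.
    - rewrite -subr_ge0 -(pmulr_rge0 _ w0); congr (0 <= _): Hw.
      by rewrite /cross !planeE; field; rewrite gt_eqF.
  move=> /andP[]; rewrite -subr_ge0 -(pmulr_rge0 _ v0) => Hv.
  rewrite -subr_ge0 -(pmulr_rge0 _ w0) => Hw; split.
  - by congr (0 <= _): Hv; rewrite /cross !planeE; field; rewrite gt_eqF.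
  - by congr (0 <= _): Hw; rewrite /cross !planeE; field; rewrite gt_eqF.
have E : p.2 + w.2 / w.1 * (x - p.1) - (p.2 + v.2 / v.1 * (x - p.1)) =
  cross v w / (v.1 * w.1) * (x - p.1).
  by rewrite /cross; field; rewrite !gt_eqF.
have : 0 <= cross v w / (v.1 * w.1) * (x - p.1).
  by rewrite mulrAC divr_ge0// ltW// mulr_gt0.
rewrite le_eqVlt => /predU1P[e0|e0].
- by rewrite /mu lebesgue_measure_itv/= lte_fin -subr_gt0 E -e0 ltxx.
- by rewrite /mu lebesgue_measure_itv/= lte_fin -subr_gt0 E e0 -EFinB E.
Qed.

Lemma wedge_area (E : set (plane R)) v w p (a b : R) : a <= b ->
  (forall p, E p -> a <= p.1 <= b) ->
  (forall x, a < x < b -> [/\ 0 < v.1, 0 < w.1, 0 <= cross v w * (x - p.1) &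
    forall y, E (x, y) <-> 0 <= cross v ((x, y) - p) /\ 0 <= cross ((x, y) - p) w]) ->
  mu2 E = ((b - a) * (cross v w / (v.1 * w.1) * (a - p.1) +
                      cross v w / (v.1 * w.1) * (b - p.1)) / 2)%:E.
Proof.
move=> ab Eab HE; apply: strip_area => // x /HE[v0 w0 vw Ex].
rewrite -wedge_section//; congr mu; apply/seteqP.
by split=> y; rewrite /xsection/= inE => /Ex.
Qed.

Lemma measurable_half_plane p q :
  measurable ([set r | 0 <= cross q (r - p)] : set (R * R)).
Proof.
have -> : [set r | 0 <= cross q (r - p)] =
    setT `&` (fun r : R * R => q.1 * (r.2 - p.2) - q.2 * (r.1 - p.1)) @^-1` `[0, +oo[.
  by rewrite setTI; apply/seteqP; split=> r /=; rewrite in_itv/= andbT.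
apply: measurable_funB => //.
- by apply: measurable_funM => //; apply: measurable_funB => //; exact: measurable_snd.
- by apply: measurable_funM => //; apply: measurable_funB => //; exact: measurable_fst.
Qed.

Definition triangle a b c : set (R * R) :=
  [set p | [/\ 0 <= cross (b - a) (p - a), 0 <= cross (c - b) (p - b) &
               0 <= cross (a - c) (p - c)]].

Lemma measurable_triangle a b c : measurable (triangle a b c).
Proof.
have -> : triangle a b c = [set p | 0 <= cross (b - a) (p - a)] `&`
    [set p | 0 <= cross (c - b) (p - b)] `&` [set p | 0 <= cross (a - c) (p - c)].
  by apply/seteqP; split=> p /= => [[? ? ?]|[[? ?] ?]].
by do 2?apply: measurableI; exact: measurable_half_plane.
Qed.

Lemma triangle_rot a b c : triangle a b c = triangle b c a.
Proof. by apply/seteqP; split=> p [? ? ?]. Qed.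

Lemma area_split (E : set (R * R)) (x : R) : measurable E ->
  mu2 E = (mu2 (E `&` [set p | (p.1 <= x)%R]) + mu2 (E `&` [set p | (x < p.1)%R]))%E.
Proof.
move=> mE; have mx : measurable ([set p | p.1 <= x] : set (R * R)).
  rewrite (_ : mkset _ = setT `&` fst @^-1` `]-oo, x]).
    exact: measurable_fst.
  by rewrite setTI; apply/seteqP; split=> r /=; rewrite in_itv.
have mx' : measurable ([set p | x < p.1] : set (R * R)).
  rewrite (_ : mkset _ = setT `&` fst @^-1` `]x, +oo[).
    exact: measurable_fst.
  by rewrite setTI; apply/seteqP; split=> r /=; rewrite in_itv/= andbT.
rewrite -measureU; first last.
- apply/seteqP; split=> // p [[_ /= p1] [_ /=]]; rewrite ltNge p1//.
- exact: measurableI.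
- exact: measurableI.
rewrite -setIUr (_ : _ `|` _ = setT) ?setIT//.
by apply/seteqP; split=> // p _; have [px|px] := leP p.1 x; [left|right].
Qed.

(** The case [x = 0], where the division takes its default value, occurs for triangles with a
    vertical side. *)
Lemma wedge_area_simpl (s x y : R) : y != 0 -> x * (s / (x * y) * x) = x * s / y.
Proof.
move=> y0; have [->|x0] := eqVneq x 0; first by rewrite !mul0r.
by field; rewrite x0 y0.
Qed.

(** The vertical line through the vertex with the middle abscissa cuts the triangle into two
    truncated wedges, with apexes at the leftmost and rightmost vertices. On each piece the
    inequality of the third side follows from the other two. *)
Lemma triangle_area_leftmost a b c : 0 < cross (b - a) (c - a) ->
  a.1 <= b.1 -> a.1 <= c.1 ->
  mu2 (triangle a b c) = (cross (b - a) (c - a) / 2)%:E.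
Proof.
move=> S0 ab ac; rewrite (area_split (Order.min b.1 c.1) (measurable_triangle a b c)).
set S := cross _ _ in S0 *.
have Sx p : S * (p.1 - a.1) = cross (a - c) (p - c) * (b.1 - a.1) +
  cross (b - a) (p - a) * (c.1 - a.1).
  by rewrite /S /cross !planeE; ring.
have Sxa p : triangle a b c p -> a.1 <= p.1.
  move=> [p1 p2 p3]; rewrite -subr_ge0 -(pmulr_rge0 _ S0) Sx.
  by rewrite addr_ge0// mulr_ge0// subr_ge0.
have [bc|cb] := leP b.1 c.1.
- have ac' : a.1 < c.1.
    rewrite lt_neqAle ac andbT; apply: contraTneq S0 => e; have e' : b.1 = a.1.
      by apply/eqP; rewrite eq_le ab {1}e bc.
    by rewrite /S /cross !planeE e' -e !subrr mul0r mulr0 subrr ltxx.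
  have Sxc p : triangle a b c p -> p.1 <= c.1.
    move=> [p1 p2 p3]; rewrite -subr_ge0 -(pmulr_rge0 _ S0).
    have -> : S * (c.1 - p.1) = cross (c - b) (p - b) * (c.1 - a.1) +
      cross (a - c) (p - c) * (c.1 - b.1).
      by rewrite /S /cross !planeE; ring.
    by rewrite addr_ge0// mulr_ge0// subr_ge0.
  rewrite (@wedge_area _ (b - a) (c - a) a a.1 b.1)//; last 2 first.
  + by move=> p [/Sxa -> ].
  + move=> x /andP[ax xb]; rewrite !planeE !subr_gt0 (lt_trans ax xb) ac'.
    split=> //; first by rewrite mulr_ge0 ?(ltW S0)// subr_ge0 ltW.
    move=> y; split=> [[[p1 _ p3] _]|[p1 p3]].
      by split=> //; move: p3; congr (0 <= _); rewrite /cross !planeE; ring.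
    have {}p3 : 0 <= cross (a - c) ((x, y) - c).
      by move: p3; congr (0 <= _); rewrite /cross !planeE; ring.
    split; last by rewrite /= ltW.
    split=> //; have ab' : 0 < b.1 - a.1 by rewrite subr_gt0 (lt_trans ax).
    rewrite -(pmulr_rge0 _ ab').
    have -> : (b.1 - a.1) * cross (c - b) ((x, y) - b) =
      S * (b.1 - x) + cross (b - a) ((x, y) - a) * (c.1 - b.1).
      by rewrite /S /cross !planeE; ring.
    by rewrite addr_ge0// mulr_ge0// ?(ltW S0)// subr_ge0// ltW.
  rewrite (@wedge_area _ (c - b) (c - a) c b.1 c.1)//; last 2 first.
  + by move=> p [/Sxc -> /= /ltW ->].
  + move=> x /andP[bx xc]; rewrite !planeE !subr_gt0 (lt_trans bx xc) ac'.
    have SE : cross (c - b) (c - a) = - S by rewrite /S /cross !planeE; ring.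
    split=> //; first by rewrite SE mulNr -mulrN opprB mulr_ge0 ?(ltW S0)// subr_ge0 ltW.
    move=> y; have e1 : cross (c - b) ((x, y) - c) = cross (c - b) ((x, y) - b).
      by rewrite /cross !planeE; ring.
    have e2 : cross ((x, y) - c) (c - a) = cross (a - c) ((x, y) - c).
      by rewrite /cross !planeE; ring.
    rewrite e1 e2; split=> [[[_ p2 p3] _]//|[p2 p3]]; split=> //.
    split=> //; have bc' : 0 < c.1 - b.1 by rewrite subr_gt0 (lt_trans bx).
    rewrite -(pmulr_rge0 _ bc').
    have -> : (c.1 - b.1) * cross (b - a) ((x, y) - a) =
      S * (x - b.1) + cross (c - b) ((x, y) - b) * (b.1 - a.1).
      by rewrite /S /cross !planeE; ring.
    by rewrite addr_ge0// mulr_ge0// ?(ltW S0)// subr_ge0// ltW.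
  rewrite -EFinD; congr (_%:E).
  have SE : cross (c - b) (c - a) = - S by rewrite /S /cross !planeE; ring.
  have SE' : cross (b - a) (c - a) = S by [].
  have ca : c.1 - a.1 != 0 by rewrite gt_eqF// subr_gt0.
  rewrite SE SE' !planeE !subrr !mulr0 add0r addr0 wedge_area_simpl//.
  rewrite -(opprB c.1 b.1) mulrN mulNr mulNr opprK wedge_area_simpl//.
  by field.
- have ab' : a.1 < b.1 by exact: le_lt_trans cb.
  have Sxb p : triangle a b c p -> p.1 <= b.1.
    move=> [p1 p2 p3]; rewrite -subr_ge0 -(pmulr_rge0 _ S0).
    have -> : S * (b.1 - p.1) = cross (c - b) (p - b) * (b.1 - a.1) +
      cross (b - a) (p - a) * (b.1 - c.1).
      by rewrite /S /cross !planeE; ring.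
    by rewrite addr_ge0// mulr_ge0// subr_ge0 ltW.
  rewrite (@wedge_area _ (b - a) (c - a) a a.1 c.1)//; last 2 first.
  + by move=> p [/Sxa -> ].
  + move=> x /andP[ax xc]; rewrite !planeE !subr_gt0 (lt_trans ax xc) ab'.
    split=> //; first by rewrite mulr_ge0 ?(ltW S0)// subr_ge0 ltW.
    move=> y; have e1 : cross ((x, y) - a) (c - a) = cross (a - c) ((x, y) - c).
      by rewrite /cross !planeE; ring.
    rewrite e1; split=> [[[p1 _ p3] _]//|[p1 p3]].
    split; last by rewrite /= ltW.
    split=> //; have ac' : 0 < c.1 - a.1 by rewrite subr_gt0 (lt_trans ax).
    rewrite -(pmulr_rge0 _ ac').
    have -> : (c.1 - a.1) * cross (c - b) ((x, y) - b) =
      S * (c.1 - x) + cross (a - c) ((x, y) - c) * (b.1 - c.1).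
      by rewrite /S /cross !planeE; ring.
    by rewrite addr_ge0// mulr_ge0// ?(ltW S0)// subr_ge0 ltW.
  rewrite (@wedge_area _ (b - a) (b - c) b c.1 b.1)//; last 3 first.
  + by rewrite ltW.
  + by move=> p [/Sxb -> /= /ltW ->].
  + move=> x /andP[cx xb]; rewrite !planeE !subr_gt0 (lt_trans cx xb) ab'.
    have SE : cross (b - a) (b - c) = - S by rewrite /S /cross !planeE; ring.
    split=> //; first by rewrite SE mulNr -mulrN opprB mulr_ge0 ?(ltW S0)// subr_ge0 ltW.
    move=> y; have e1 : cross (b - a) ((x, y) - b) = cross (b - a) ((x, y) - a).
      by rewrite /cross !planeE; ring.
    have e2 : cross ((x, y) - b) (b - c) = cross (c - b) ((x, y) - b).
      by rewrite /cross !planeE; ring.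
    rewrite e1 e2; split=> [[[p1 p2 _] _]//|[p1 p2]]; split=> //.
    split=> //; have cb' : 0 < b.1 - c.1 by rewrite subr_gt0.
    rewrite -(pmulr_rge0 _ cb').
    have -> : (b.1 - c.1) * cross (a - c) ((x, y) - c) =
      S * (x - c.1) + cross (c - b) ((x, y) - b) * (c.1 - a.1).
      by rewrite /S /cross !planeE; ring.
    by rewrite addr_ge0// mulr_ge0// ?(ltW S0)// subr_ge0// ltW.
  rewrite -EFinD; congr (_%:E).
  have SE : cross (b - a) (b - c) = - S by rewrite /S /cross !planeE; ring.
  have SE' : cross (b - a) (c - a) = S by [].
  have ba : b.1 - a.1 != 0 by rewrite gt_eqF// subr_gt0.
  rewrite SE SE' !planeE !subrr !mulr0 add0r addr0.
  rewrite -(opprB b.1 c.1) mulrN mulNr mulNr opprK.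
  rewrite ![(b.1 - a.1) * (_ - _)]mulrC !wedge_area_simpl//.
  by field.
Qed.

Lemma cross_rot a b c : cross (c - b) (a - b) = cross (b - a) (c - a).
Proof. by rewrite /cross !planeE; ring. Qed.

Lemma triangle_area a b c : 0 < cross (b - a) (c - a) ->
  mu2 (triangle a b c) = (cross (b - a) (c - a) / 2)%:E.
Proof.
move=> S0; have [ab|ba] := leP a.1 b.1.
  have [ac|ca] := leP a.1 c.1; first exact: triangle_area_leftmost.
  rewrite 2!triangle_rot -(cross_rot a b c) -(cross_rot b c a).
  apply: triangle_area_leftmost; rewrite ?(ltW ca) ?(ltW (lt_le_trans ca ab))//.
  by rewrite (cross_rot b c a) (cross_rot a b c).
have [bc|cb] := leP b.1 c.1.
  rewrite triangle_rot -(cross_rot a b c).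
  by apply: triangle_area_leftmost; rewrite ?(ltW ba) ?(cross_rot a b c).
rewrite 2!triangle_rot -(cross_rot a b c) -(cross_rot b c a).
apply: triangle_area_leftmost; rewrite ?(ltW cb) ?(ltW (lt_trans cb ba))//.
by rewrite (cross_rot b c a) (cross_rot a b c).
Qed.

(** A vertical line is a strip of width zero; any other line has singletons as vertical sections. *)
Lemma line_null p v : v != 0 -> mu2 [set r | cross v (r - p) = 0] = 0%E.
Proof.
move=> v0; have [v1|v1] := eqVneq v.1 0.
  have v2 : v.2 != 0.
    by apply: contra v0 => /eqP v2; apply/eqP; rewrite [v]surjective_pairing v1 v2.
  rewrite (@strip_area _ 0 0 p.1 p.1)//.
  - by rewrite subrr !mul0r.
  - move=> r /= /eqP; rewrite /cross v1 mul0r sub0r oppr_eq0 mulf_eq0 (negbTE v2)/=.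
    by rewrite subr_eq0 => /eqP ->; rewrite lexx.
  - by move=> x /andP[px xp]; have := lt_trans px xp; rewrite ltxx.
rewrite /mu2 /product_measure1 integral0_eq// => x _ /=.
rewrite (_ : xsection _ x = [set p.2 + v.2 / v.1 * (x - p.1)]) ?lebesgue_measure_set1//.
apply/seteqP; split=> y; rewrite /xsection/= inE/=.
  move=> /eqP; rewrite /cross !planeE subr_eq0 => /eqP e.
  apply: (mulfI v1); rewrite mulrDr mulrA (mulrCA v.1) divff// mulr1 -e.
  by ring.
by move=> ->; rewrite /cross !planeE; field.
Qed.

Lemma cross_flip a b p : cross (b - a) (p - a) = - cross (a - b) (p - b).
Proof. by rewrite /cross !planeE; ring. Qed.

Lemma region_triangles V : ccw V ->
  region V = triangle (V 0) (V 1) (V 2) `|` triangle (V 2) (V 3) (V 0).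
Proof.
move=> cV; have T0 := cV 0; have T1 := cV 1; have T2 := cV 2; have T3 := cV 3.
rewrite region_ccw//; apply/seteqP; split=> p /=.
  move=> Hp; have := Hp 0; have := Hp 1; have := Hp 2; have := Hp 3.
  rewrite /half_plane !ord4E => H3 H2 H1 H0.
  have [d|d] := leP 0 (cross (V 0 - V 2) (p - V 2)); [by left; split|right; split=> //].
  by rewrite cross_flip oppr_ge0 ltW.
move=> [[p1 p2 p3]|[p1 p2 p3]] i; elim/ord4_ind: i; rewrite /half_plane !ord4E//.
(* Multiplied by a positive turn, each missing half-plane function is a nonnegative combination of
   the functions defining the triangle. *)
- rewrite -(pmulr_rge0 _ T0); set y := _ * _.
  have -> : y = cross (V 2 - V 1) (p - V 1) * turn V 2 +
    cross (V 0 - V 2) (p - V 2) * turn V 1.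
    by rewrite /y /turn /cross !ord4E !planeE; ring.
  by rewrite addr_ge0// mulr_ge0// ltW.
- rewrite -(pmulr_rge0 _ T0); set y := _ * _.
  have -> : y = cross (V 0 - V 2) (p - V 2) * turn V 3 +
    cross (V 1 - V 0) (p - V 0) * turn V 2.
    by rewrite /y /turn /cross !ord4E !planeE; ring.
  by rewrite addr_ge0// mulr_ge0// ltW.
- rewrite -(pmulr_rge0 _ T2); set y := _ * _.
  have -> : y = cross (V 0 - V 3) (p - V 3) * turn V 0 +
    cross (V 2 - V 0) (p - V 0) * turn V 3.
    by rewrite /y /turn /cross !ord4E !planeE; ring.
  by rewrite addr_ge0// mulr_ge0// ltW.
- rewrite -(pmulr_rge0 _ T2); set y := _ * _.
  have -> : y = cross (V 2 - V 0) (p - V 0) * turn V 1 +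
    cross (V 3 - V 2) (p - V 2) * turn V 0.
    by rewrite /y /turn /cross !ord4E !planeE; ring.
  by rewrite addr_ge0// mulr_ge0// ltW.
Qed.

Lemma ccw_area V : ccw V -> area V = ((turn V 0 + turn V 2) / 2)%:E.
Proof.
move=> cV; pose T1 := triangle (V 0) (V 1) (V 2); pose T2 := triangle (V 2) (V 3) (V 0).
have mT1 : measurable T1 by exact: measurable_triangle.
have mT2 : measurable T2 by exact: measurable_triangle.
have A1 : mu2 T1 = (turn V 0 / 2)%:E.
  by rewrite /T1 triangle_area; [|have := cV 0]; rewrite /turn !ord4E.
have A2 : mu2 T2 = (turn V 2 / 2)%:E.
  by rewrite /T2 triangle_area; [|have := cV 2]; rewrite /turn !ord4E.
have A3 : mu2 (T2 `&` T1) = 0%E.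
  pose N : set (R * R) := [set r | cross (V 2 - V 0) (r - V 0) = 0].
  have mN : measurable N.
    rewrite (_ : N = [set r | 0 <= cross (V 2 - V 0) (r - V 0)] `&`
        [set r | 0 <= cross (V 0 - V 2) (r - V 2)]).
      by apply: measurableI; exact: measurable_half_plane.
    apply/seteqP; split=> r; rewrite /N/= (cross_flip (V 2)) oppr_ge0.
      by move=> ->; rewrite lexx.
    by move=> [r1 r2]; apply/eqP; rewrite eq_le r1 r2.
  have := @subset_measure0 _ _ _ (@lebesgue_measure R \x @lebesgue_measure R)%E (T2 `&`
    T1) N (measurableI _ _ mT2 mT1) mN; apply.
  - move=> p [[_ _ p1] [_ _]]; rewrite cross_flip oppr_ge0 => p2.
    by apply/eqP; rewrite eq_le p1 p2.
  - apply: line_null; apply: contraTneq (cV 0) => e0.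
    rewrite (_ : turn V 0 = - cross (V 2 - V 0) (V 1 - V 0)).
      by rewrite e0 /cross !planeE !mul0r subrr oppr0 ltxx.
    by rewrite /turn /cross !ord4E !planeE; ring.
rewrite /area region_triangles// -/T1 -/T2 -/mu2.
rewrite (_ : T1 `|` T2 = T1 `|` (T2 `\` T1)); last first.
  by rewrite setDE setUIr setUv setIT.
have A2' : mu2 T2 = (mu2 (T2 `\` T1) + mu2 (T2 `&` T1))%E.
  exact: (@measureDI _ _ _ (@lebesgue_measure R \x @lebesgue_measure R)%E).
transitivity (mu2 T1 + mu2 (T2 `\` T1))%E.
  apply: (@measureU _ _ _ (@lebesgue_measure R \x @lebesgue_measure R)%E) => //.
    exact: measurableD.
  by apply/seteqP; split=> // p [? []].
move: A2'; rewrite A3 adde0 => <-; rewrite A1 A2 -EFinD; congr EFin; by field.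
Qed.

End Area.

(** * Tangent lengths *)

Section Tangent.
Variable R : realType.
Implicit Types (V : vertices R) (p q a b c d u v w : plane R) (t : 'I_4 -> R).

Lemma dot_ge0 v : 0 <= dot v v.
Proof. by rewrite /dot addr_ge0// -expr2 sqr_ge0. Qed.

Lemma dot_eq0 v : dot v v = 0 -> v = 0.
Proof.
move/eqP; rewrite /dot -!expr2 paddr_eq0 ?sqr_ge0// !sqrf_eq0 => /andP[/eqP v1 /eqP v2].
by rewrite [v]surjective_pairing v1 v2.
Qed.

Lemma dist_ge0 p q : 0 <= dist p q.
Proof. exact: sqrtr_ge0. Qed.

Lemma sqr_dist p q : dist p q ^+ 2 = dot (q - p) (q - p).
Proof. by rewrite sqr_sqrtr// dot_ge0. Qed.

Lemma dist_eq p q r s : dot (q - p) (q - p) = dot (s - r) (s - r) -> dist p q = dist r s.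
Proof. by rewrite /dist => ->. Qed.

Lemma sqr_side V i : side_length V i ^+ 2 = dot (edge V i) (edge V i).
Proof. exact: sqr_dist. Qed.

Lemma ccw_side_gt0 V i : ccw V -> 0 < side_length V i.
Proof.
move=> cV; rewrite lt_neqAle dist_ge0 andbT eq_sym; apply: contraTneq (cV i) => s0.
have /dot_eq0 e0 : dot (edge V i) (edge V i) = 0 by rewrite -sqr_side s0 expr0n.
by rewrite /turn -/(edge V i) e0 /cross !planeE !mul0r subrr ltxx.
Qed.

(* [t i] is the distance from the vertex [V i] to the points where the circle of
   centre [c] and radius 2 touches the sides through that vertex. *)
Definition tangent_lengths V c t : Prop := forall i,
  [/\ 0 < t i, side_length V i = t i + t (i + 1),
      dot (edge V i) (c - V i) = t i * side_length V i &
      cross (edge V i) (c - V i) = 2 * side_length V i].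

Lemma tangent_foot V i c rho : 0 < side_length V i ->
  tangent_to_side V i (circle c rho) ->
  exists s : R, [/\ 0 <= s, s <= 1,
    dot (edge V i) (c - V i) = s * side_length V i ^+ 2 &
    cross (edge V i) (c - V i) ^+ 2 = rho ^+ 2 * side_length V i ^+ 2].
Proof.
move=> a0 [p [s /=]]; rewrite in_itv/= => /andP[s0 s1] pE Cp; exists s.
have [cp lp] : (circle c rho `&` line (V i) (V (i + 1))) p by rewrite Cp.
set e := edge V i; set n := side_length V i in a0 *.
have nE : n ^+ 2 = dot e e by exact: sqr_side.
have n0 : n ^+ 2 != 0 by rewrite expf_neq0// gt_eqF.
(* The foot of the perpendicular from [c] is [p + k *: e], and [p + (2 * k) *: e] is the mirror
   image of [p] in it: a second point of the circle on the line unless [k = 0]. *)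
pose k := dot (c - p) e / n ^+ 2.
have kE : k * dot e e = dot (c - p) e by rewrite -nE divfK.
have k0 : k = 0.
  have : (circle c rho `&` line (V i) (V (i + 1))) (p + (2 * k) *: e).
    split.
      rewrite /circle/= -cp; apply: dist_eq.
      have -> : dot (p + (2 * k) *: e - c) (p + (2 * k) *: e - c) =
        dot (p - c) (p - c) + 4 * k * (k * dot e e - dot (c - p) e).
        by rewrite /dot !planeE; ring.
      by rewrite kE subrr mulr0 addr0.
    exists (s + 2 * k) => //; rewrite -pE /e /edge.
    by rewrite [LHS]surjective_pairing [RHS]surjective_pairing !planeE; congr pair; ring.
  rewrite Cp/= => /(congr1 (fun q => dot (q - p) (q - p))) /eqP.
  have -> : dot (p + (2 * k) *: e - p) (p + (2 * k) *: e - p) = (2 * k) ^+ 2 * dot e e.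
    by rewrite /dot !planeE; ring.
  rewrite /dot subrr !mulr0 addr0 -/(dot e e) -nE mulf_eq0 (negbTE n0) orbF.
  by rewrite sqrf_eq0 mulf_eq0 pnatr_eq0 => /eqP.
have d0 : dot (c - p) e = 0 by rewrite -kE k0 mul0r.
have pV : p - V i = s *: e.
  rewrite -pE /e /edge.
  by rewrite [LHS]surjective_pairing [RHS]surjective_pairing !planeE; congr pair; ring.
have cV : c - V i = (c - p) + s *: e by rewrite -pV addrA subrK.
split=> //.
- rewrite cV nE; have -> : dot e (c - p + s *: e) = dot (c - p) e + s * dot e e.
    by rewrite /dot !planeE; ring.
  by rewrite d0 add0r.
- rewrite cV -cp sqr_dist nE.
  have -> : dot (p - c) (p - c) = dot (c - p) (c - p) by rewrite /dot !planeE; ring.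
  have -> : cross e (c - p + s *: e) ^+ 2 =
    dot (c - p) (c - p) * dot e e - dot (c - p) e ^+ 2.
    by rewrite /dot /cross !planeE; ring.
  by rewrite d0 expr0n subr0.
Qed.

(** In the orthonormal frame at [V i] directed along side [i], the point [c] has coordinates [x] and
    [y]. *)
Lemma dist_vertex V i c (x y : R) : side_length V i != 0 ->
  dot (edge V i) (c - V i) = x * side_length V i ->
  cross (edge V i) (c - V i) = y * side_length V i ->
  dot (c - V i) (c - V i) = x ^+ 2 + y ^+ 2 /\
  dot (c - V (i + 1)) (c - V (i + 1)) = (side_length V i - x) ^+ 2 + y ^+ 2.
Proof.
move=> a0 dx cy; set n := side_length V i in a0 dx cy *.
have nE : n ^+ 2 = dot (edge V i) (edge V i) by exact: sqr_side.
have E : dot (c - V i) (c - V i) = x ^+ 2 + y ^+ 2.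
  apply: (mulfI (expf_neq0 2 a0)); rewrite {1}nE.
  transitivity (dot (edge V i) (c - V i) ^+ 2 + cross (edge V i) (c - V i) ^+ 2).
    by rewrite /dot /cross !planeE; ring.
  by rewrite dx cy; ring.
split=> //.
transitivity (dot (c - V i) (c - V i) - 2 * dot (edge V i) (c - V i) +
  dot (edge V i) (edge V i)).
  by rewrite /dot /edge !planeE; ring.
by rewrite E dx -nE; ring.
Qed.

Lemma tangential_lengths V : ccw V -> tangential V -> equable V ->
  exists c t, tangent_lengths V c t.
Proof.
move=> cV [c [rho [rho0 circ tang]]] eqV.
pose n i := side_length V i.
have n0 i : 0 < n i by exact: ccw_side_gt0.
pose t i := dot (edge V i) (c - V i) / n i.
(* The centre is the midpoint of two opposite points of the circle, both of which lie in the
   region. *)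
have Hc i : 0 <= half_plane V i c.
  have circE (s : R) : `|s| = rho -> region V (c + (s, 0)).
    move=> sE; apply: circ; rewrite /circle/= /dist.
    rewrite -sE -sqrtr_sqr; congr Num.sqrt; rewrite /dot !planeE; ring.
  have := circE rho (gtr0_norm rho0); have := circE (- rho).
  rewrite normrN => /(_ (gtr0_norm rho0)); rewrite region_ccw//= => /(_ i) H1 /(_ i) H2.
  have -> : half_plane V i c = (half_plane V i (c + (- rho, 0)) + half_plane V i (c +
    (rho, 0))) / 2.
    by rewrite /half_plane /cross !planeE; field.
  by rewrite divr_ge0// addr_ge0.
have tE i : [/\ 0 <= t i, t i <= n i, dot (edge V i) (c - V i) = t i * n i &
    cross (edge V i) (c - V i) = rho * n i].
  have [s [s0 s1 dE cE]] := tangent_foot (n0 i) (tang i).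
  have tsE : t i = s * n i by rewrite /t dE expr2 mulrA mulfK// gt_eqF.
  rewrite tsE; split.
  - by rewrite mulr_ge0// ltW.
  - by rewrite ler_piMl// ltW.
  - by rewrite dE expr2 mulrA.
  - move: cE => /eqP; rewrite -exprMn eqrXn2//.
    + by move=> /eqP.
    + exact: Hc.
    + by rewrite mulr_ge0// ltW.
(* Measuring the distance from [c] to [V (i + 1)] along both of its sides gives (n_i - t_i)^2 =
   t_(i+1)^2, and both bases are nonnegative. *)
have tS i : n i = t i + t (i + 1).
  have [_ t1 dE cE] := tE i; have [t2 _ dE' cE'] := tE (i + 1).
  have [_ E1] := dist_vertex (lt0r_neq0 (n0 i)) dE cE.
  have [E2 _] := dist_vertex (lt0r_neq0 (n0 (i + 1))) dE' cE'.
  move: E1; rewrite E2 => /addIr /eqP; rewrite eqrXn2// ?subr_ge0// => /eqP ->.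
  by rewrite /n addrC subrK.
have rhoE : rho = 2.
  have pE : perimeter V = \sum_i n i by [].
  move: eqV; rewrite /equable ccw_area// => -[aE].
  have p0 : perimeter V != 0.
    by rewrite gt_eqF// pE sum4 !addr_gt0.
  apply: (mulIf p0).
  rewrite -{2}aE -(half_plane_sum V c) mulrCA divff ?pnatr_eq0// mulr1 pE mulr_sumr.
  by apply: eq_bigr => i _; have [_ _ _ <-] := tE i.
exists c, t => i; have [t0 _ dE cE] := tE i; split=> //; last by rewrite -rhoE.
(* If [t i] vanished, both sides at [V i] would touch the circle there; [c - V i] would be
   orthogonal to both edges, making them parallel. *)
rewrite lt_neqAle t0 andbT eq_sym; apply/eqP => ti0.
have [j jE] : exists j, i = j + 1 by exists (i - 1); rewrite subrK.
have [_ _ dE' cE'] := tE j.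
have dE2 : dot (edge V j) (c - V i) = 0.
  have -> : dot (edge V j) (c - V i) = dot (edge V j) (c - V j) -
    dot (edge V j) (edge V j).
    by rewrite jE /dot /edge !planeE; ring.
  have nj : n j = t j by rewrite tS -jE ti0 addr0.
  by rewrite dE' -sqr_side -/(n j) nj expr2 subrr.
have [E _] := dist_vertex (lt0r_neq0 (n0 i)) dE cE.
have : turn V j * dot (c - V i) (c - V i) =
   dot (edge V j) (c - V i) * cross (c - V i) (edge V i) +
   cross (edge V j) (c - V i) * dot (edge V i) (c - V i).
  rewrite /turn jE /edge /cross /dot -!addrA !ord4E !planeE; ring.
rewrite dE2 dE ti0 E ti0 !(mul0r, mulr0) addr0 expr0n add0r => /eqP.
rewrite mulf_eq0 sqrf_eq0 => /orP[/eqP T0|/eqP rho00].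
  by have := cV j; rewrite T0 ltxx.
by rewrite rho00 ltxx in rho0.
Qed.

End Tangent.

(** * From real tangent lengths to equations between natural numbers *)

Section Arith.
Variable R : realType.
Implicit Types (V : vertices R) (p q u v w : plane R) (t : 'I_4 -> R).

Lemma tangent_nat (t0 t1 t2 t3 : R) (m m' n0 n1 n2 n3 a b c d : nat) :
  0 < t0 -> 0 < t1 -> 0 < t2 -> 0 < t3 ->
  a%:R = t0 + t1 -> b%:R = t1 + t2 -> c%:R = t2 + t3 -> d%:R = t3 + t0 ->
  (0 < m)%N -> (m <= m')%N ->
  2 * n0%:R = m%:R * t0 -> 2 * n1%:R = m'%:R * t1 ->
  2 * n2%:R = m%:R * t2 -> 2 * n3%:R = m'%:R * t3 ->
  m%:R * (t0 ^+ 2 + 4) = 8 * (d%:R * a%:R) ->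
  m'%:R * (t1 ^+ 2 + 4) = 8 * (a%:R * b%:R) ->
  m%:R * (t2 ^+ 2 + 4) = 8 * (b%:R * c%:R) ->
  m'%:R * (t3 ^+ 2 + 4) = 8 * (c%:R * d%:R) ->
  n0%:R + n2%:R = 4 * (t0 + t1 + t2 + t3) ->
  n1%:R + n3%:R = 4 * (t0 + t1 + t2 + t3) ->
  (m, m', n0, n1, n2, n3) \in tangent_solutions.
Proof.
move=> t0p t1p t2p t3p aE bE cE dE m0 mm' N0 N1 N2 N3 E0 E1 E2 E3 S02 S13.
have M0 : 0 < m%:R :> R by rewrite ltr0n.
have m'0 : (0 < m')%N by exact: leq_trans mm'.
have M'0 : 0 < m'%:R :> R by rewrite ltr0n.
have npos (n k : nat) (s : R) : (0 < k)%N -> 0 < s -> 2 * n%:R = k%:R * s -> (0 < n)%N.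
  move=> k0 s0 e; rewrite -(ltr0n R) -(@pmulr_rgt0 _ 2)// e mulr_gt0// ltr0n//.
have sqrE (n k u v : nat) (s : R) : 2 * n%:R = k%:R * s ->
    k%:R * (s ^+ 2 + 4) = 8 * (u%:R * v%:R) -> (n ^ 2 + k ^ 2 = 2 * k * (u * v))%N.
  move=> e e'; apply/eqP; rewrite -(eqr_nat R) !(natrD, natrM, natrX); apply/eqP.
  have -> : n%:R = k%:R * s / 2 by rewrite -e mulrC mulKf// pnatr_eq0.
  have -> : 2 * k%:R * (u%:R * v%:R) = k%:R / 4 * (8 * (u%:R * v%:R)) :> R by field.
  by rewrite -e'; field.
have S0 : 0 < t0 + t1 + t2 + t3 by rewrite !addr_gt0.
(* With S the sum of the tangent lengths, t_0 + t_2 = 8 S / m and t_1 + t_3 = 8 S / m' add up to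
   S. *)
have MM : m%:R * m'%:R = 8 * (m%:R + m'%:R) :> R.
  apply: (mulIf (lt0r_neq0 S0)).
  have F1 : m%:R * (t0 + t2) = 8 * (t0 + t1 + t2 + t3)
    by rewrite mulrDr -N0 -N2 -mulrDr S02 mulrA; congr (_ * _); ring.
  have F2 : m'%:R * (t1 + t3) = 8 * (t0 + t1 + t2 + t3)
    by rewrite mulrDr -N1 -N3 -mulrDr S13 mulrA; congr (_ * _); ring.
  transitivity (m'%:R * (m%:R * (t0 + t2)) + m%:R * (m'%:R * (t1 + t3))); first by ring.
  by rewrite F1 F2; ring.
have FF : m'%:R * (t1 + t3) = m%:R * (t0 + t2).
  by rewrite !mulrDr -N0 -N1 -N2 -N3 -!mulrDr S02 S13.
apply: (@tangent_arith _ _ _ _ _ _ a b c d) => //.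
- exact: npos N0.
- exact: npos N1.
- exact: npos N2.
- exact: npos N3.
- exact: sqrE E0.
- exact: sqrE E1.
- exact: sqrE E2.
- exact: sqrE E3.
- apply/eqP; rewrite -(eqr_nat R) !(natrD, natrM) aE mulrDr.
  rewrite (mulrDr 2) [2 * (m'%:R * _)]mulrCA [2 * (m%:R * _)]mulrCA N0 N1; apply/eqP;
    ring.
- apply/eqP; rewrite -(eqr_nat R) !(natrD, natrM) bE mulrDr.
  rewrite (mulrDr 2) [2 * (m'%:R * _)]mulrCA [2 * (m%:R * _)]mulrCA N2 N1; apply/eqP;
    ring.
- by apply/eqP; rewrite -(eqr_nat R) !natrD S02 S13.
- by apply/eqP; rewrite -(eqr_nat R) !(natrD, natrM) MM.
apply/eqP; rewrite -(eqr_nat R) !(natrD, natrM); apply/eqP.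
have NE (n k : nat) (s : R) : 2 * n%:R = k%:R * s -> n%:R = k%:R * s / 2.
  by move=> <-; rewrite mulrC mulKf// pnatr_eq0.
rewrite (NE _ _ _ N0) (NE _ _ _ N1) (NE _ _ _ N2) (NE _ _ _ N3).
(* Obtained from m (t_0^2 + 4) = 8 (t_3 + t_0) (t_0 + t_1), multiplied by m': [FF] replaces m' (t_1
   + t_3) by m (t_0 + t_2), and [MM] makes the terms in t_0^2 cancel. *)
have K : 8 * (m%:R * (t0 * t2) + m'%:R * (t1 * t3)) = 4 * (m%:R * m'%:R).
  have : m'%:R * (m%:R * (t0 ^+ 2 + 4)) = 8 * (m'%:R * (t3 + t0) * (t0 + t1)).
    by rewrite E0 aE dE; ring.
  have -> : m'%:R * (m%:R * (t0 ^+ 2 + 4)) =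
    (m%:R * m'%:R) * t0 ^+ 2 + 4 * (m%:R * m'%:R) by ring.
  have -> : m'%:R * (t3 + t0) * (t0 + t1) =
    m'%:R * t0 ^+ 2 + t0 * (m'%:R * (t1 + t3)) + m'%:R * (t1 * t3) by ring.
  rewrite FF => K; apply/eqP; rewrite -subr_eq0; apply/eqP.
  have -> : 4 * (m%:R * m'%:R) = 8 * (m'%:R * t0 ^+ 2 + t0 * (m%:R * (t0 + t2)) +
    m'%:R * (t1 * t3)) - m%:R * m'%:R * t0 ^+ 2.
    by rewrite -K; ring.
  by rewrite MM; ring.
have -> : m'%:R * (m%:R * t0 / 2 * (m%:R * t2 / 2)) +
  m%:R * (m'%:R * t1 / 2 * (m'%:R * t3 / 2)) =
   m%:R * m'%:R / 32 * (8 * (m%:R * (t0 * t2) + m'%:R * (t1 * t3))) by field.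
rewrite K -mulrA; congr (_ * _).
have -> : m%:R + m'%:R = (8 * (m%:R + m'%:R)) / 8 :> R by field.
by rewrite -MM; field.
Qed.

Lemma rational_sqrt_nat (x : R) (q p N : nat) : (0 < q)%N ->
  q%:R * x = p%:R -> x ^+ 2 = N%:R -> exists k : nat, x = k%:R.
Proof.
move=> q0 qx xN; have q0' : q%:R != 0 :> R by rewrite pnatr_eq0 -lt0n.
have /dvdnP[k kE] : (q %| p)%N.
  rewrite -(@dvdn_pexp2r _ _ 2)//; apply/dvdnP; exists N; apply/eqP.
  by rewrite -(eqr_nat R) natrX -qx natrM natrX exprMn xN mulrC.
by exists k; apply: (mulfI q0'); rewrite qx kE natrM mulrC.
Qed.

Lemma int_ge0_nat (x : R) : x \is a Num.int -> 0 <= x -> exists k : nat, x = k%:R.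
Proof. by move=> xi x0; apply/natrP; rewrite natrEint xi. Qed.

(** Here x and y will be opposite sides, and 4 (x + y) twice the area. As x^2 - y^2 = (x - y) (x +
    y), the difference is rational too, so x is a rational number with integer square. *)
Lemma sqrt_sum_nat (x y : R) : 0 < x -> 0 < y ->
  x ^+ 2 \is a Num.int -> y ^+ 2 \is a Num.int -> 4 * (x + y) \is a Num.int ->
  exists k : nat, x = k%:R.
Proof.
move=> x0 y0 xi yi si.
have s0 : 0 < 4 * (x + y) by rewrite mulr_gt0// addr_gt0.
have [k kE] := int_ge0_nat si (ltW s0).
have [N NE] := int_ge0_nat xi (sqr_ge0 x).
have e : 8 * (4 * (x + y)) * x = (4 * (x + y)) ^+ 2 + 16 * (x ^+ 2 - y ^+ 2) by ring.
have [||p pE] := @int_ge0_nat (8 * (4 * (x + y)) * x).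
- by rewrite e rpredD ?rpredX// rpredM ?rpredB// rpred_nat.
- by rewrite mulr_ge0 ?(ltW x0)// mulr_ge0// ltW.
apply: (@rational_sqrt_nat x (8 * k) p N) => //.
- by rewrite muln_gt0/= -(ltr0n R) -kE.
- by rewrite natrM -kE.
Qed.

End Arith.

(** * Integrality and classification of the tangent lengths *)

Section Classification.
Variable R : realType.
Implicit Types (V : vertices R) (p q u v w : plane R) (t : 'I_4 -> R).

(* [a a' (1 - cos th)] for the sides meeting at [V (i + 1)] with interior angle
   [th]: the edge vectors make the angle [pi - th]. *)
Definition corner V i : R :=
  side_length V i * side_length V (i + 1) + dot (edge V i) (edge V (i + 1)).

Lemma ord4D (i : 'I_4) : (((i + 1 + 1 = i + 2)%R * (i + 1 + 2 = i + 3)%R * (i + 1 + 3 =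
  i)%R) *
  ((i + 2 + 1 = i + 3)%R * (i + 2 + 2 = i)%R * (i + 2 + 3 = i + 1)%R) *
  ((i + 3 + 1 = i)%R * (i + 3 + 2 = i + 1)%R * (i + 3 + 3 = i + 2)%R))%type.
Proof. by rewrite -!addrA !ord4E !addr0. Qed.

Lemma tangent_side_gt0 V c t i : tangent_lengths V c t -> 0 < side_length V i.
Proof. by move=> tV; have [t0 -> _ _] := tV i; have [t1 _ _ _] := tV (i + 1);
  rewrite addr_gt0. Qed.

(** The half-angle formulas for sin and 1 - cos at [V (i + 1)]. They come from resolving both edges
    along [w = c - V (i + 1)], whose squared length is t^2 + 4. *)
Lemma vertex_relations V c t i : tangent_lengths V c t ->
  turn V i * (t (i + 1) ^+ 2 + 4) =
    4 * t (i + 1) * (side_length V i * side_length V (i + 1)) /\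
  corner V i * (t (i + 1) ^+ 2 + 4) = 8 * (side_length V i * side_length V (i + 1)).
Proof.
move=> tV; have [_ ai di ci] := tV i; have [_ _ dj cj] := tV (i + 1).
have aj0 := lt0r_neq0 (tangent_side_gt0 (i + 1) tV).
have [ww' _] := dist_vertex aj0 dj cj.
set w := c - V (i + 1) in dj cj ww'.
have {ww'} ww : dot w w = t (i + 1) ^+ 2 + 4 by rewrite ww'; ring.
have dw : dot (edge V i) w = - t (i + 1) * side_length V i.
  have -> : dot (edge V i) w = dot (edge V i) (c - V i) - dot (edge V i) (edge V i).
    by rewrite /w /dot /edge !planeE; ring.
  by rewrite di -sqr_side; set n := side_length V i in ai *;
    rewrite -[t i](addrK (t (i + 1))) -ai; ring.
have cw : cross (edge V i) w = 2 * side_length V i.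
  by rewrite -ci /w /cross /edge !planeE; ring.
have tE : turn V i = cross (edge V i) (edge V (i + 1)).
  by rewrite /turn /edge !ord4D /cross !planeE; ring.
rewrite /corner tE; move: (edge V i) (edge V (i +
  1)) w (side_length V i) (side_length V (i + 1)) dw cw dj cj ww.
move=> E F w x y dE cE dF cF ww; split; rewrite -ww.
- transitivity (cross E w * dot F w - dot E w * cross F w).
    by rewrite /cross /dot; ring.
  by rewrite dE cE dF cF; ring.
- transitivity (x * y * dot w w + (dot E w * dot F w + cross E w * cross F w)).
    by rewrite /cross /dot; ring.
  by rewrite dE cE dF cF ww; ring.
Qed.

Lemma corner_opp V c t i : tangent_lengths V c t -> corner V i = corner V (i + 2).
Proof.
move=> tV; have [_ s0 _ _] := tV i; have [_ s1 _ _] := tV (i + 1).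
have [_ s2 _ _] := tV (i + 2); have [_ s3 _ _] := tV (i + 3).
rewrite /corner !ord4D in s0 s1 s2 s3 *.
(* Twice a corner is the squared diagonal minus the squared difference of the two sides; opposite
   corners share the diagonal. *)
have H j : 2 * (side_length V j * side_length V (j + 1) + dot (edge V j) (edge V (j +
  1))) =
   dot (V (j + 2) - V j) (V (j + 2) - V j) - (side_length V j - side_length V (j +
     1)) ^+ 2.
  rewrite sqrrB !sqr_side /dot /edge !ord4D !planeE; ring.
apply: (@mulfI _ 2); first by rewrite pnatr_eq0.
have := H (i + 2); rewrite !ord4D => ->; rewrite H s0 s1 s2 s3 /dot !planeE; ring.
Qed.

Lemma lattice_edge V i : lattice V -> (edge V i).1 \is a Num.int /\ (edge V i).2 \is a
  Num.int.
Proof.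
by move=> lV; rewrite /edge !planeE; have [? ?] := lV i; have [? ?] := lV (i + 1); split;
  rewrite rpredB.
Qed.

Lemma lattice_dot V i j : lattice V -> dot (edge V i) (edge V j) \is a Num.int.
Proof.
move=> lV; have [? ?] := lattice_edge i lV; have [? ?] := lattice_edge j lV.
by rewrite /dot rpredD// rpredM.
Qed.

Lemma lattice_turn V i : lattice V -> turn V i \is a Num.int.
Proof.
move=> lV; rewrite /turn /cross !planeE.
have [? ?] := lV i; have [? ?] := lV (i + 1); have [? ?] := lV (i + 2).
by rewrite rpredB// rpredM// rpredB.
Qed.

(** Opposite turns add up to twice the area, that is, twice the perimeter, and each tangent length
    enters the perimeter twice. *)
Lemma turn_perimeter V c t i : ccw V -> equable V -> tangent_lengths V c t ->
  turn V i + turn V (i + 2) = 4 * (t i + t (i + 1) + t (i + 2) + t (i + 3)).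
Proof.
move=> cV eV tV.
have [_ s0 _ _] := tV 0; have [_ s1 _ _] := tV 1.
have [_ s2 _ _] := tV 2; have [_ s3 _ _] := tV 3.
rewrite !ord4E in s0 s1 s2 s3.
have T : turn V 0 + turn V 2 = 4 * (t 0 + t 1 + t 2 + t 3).
  move: eV; rewrite /equable ccw_area// /perimeter sum4 s0 s1 s2 s3 => -[e].
  have -> : turn V 0 + turn V 2 = 2 * ((turn V 0 + turn V 2) / 2) by field.
  by rewrite e; ring.
have := turn_sum V; rewrite T => T'.
elim/ord4_ind: i; rewrite !ord4E.
- by rewrite T.
- by rewrite -T'; ring.
- by rewrite addrC T; ring.
- by rewrite addrC -T'; ring.
Qed.

(** The indices of [t] start at [i + 1] because [corner V i] and [turn V i] belong to the vertex
    [V (i + 1)]. *)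
Lemma tangent_classification_at V c t i : ccw V -> lattice V -> equable V ->
  tangent_lengths V c t -> corner V i <= corner V (i + 1) ->
  exists m m' n0 n1 n2 n3 : nat,
    [/\ (m, m', n0, n1, n2, n3) \in tangent_solutions,
        2 * n0%:R = m%:R * t (i + 1), 2 * n1%:R = m'%:R * t (i + 2),
        2 * n2%:R = m%:R * t (i + 3) & 2 * n3%:R = m'%:R * t i].
Proof.
move=> cV lV eV tV mm.
have [t0 s0 _ _] := tV (i + 1); have [t1 s1 _ _] := tV (i + 2).
have [t2 s2 _ _] := tV (i + 3); have [t3 s3 _ _] := tV i.
rewrite !ord4D in s0 s1 s2 s3.
have n0 j := tangent_side_gt0 j tV.
have natn j : exists k : nat, side_length V j = k%:R.
  apply: (@sqrt_sum_nat _ _ (side_length V (j + 2))) => //.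
  - by rewrite sqr_side lattice_dot.
  - by rewrite sqr_side lattice_dot.
  - have [_ -> _ _] := tV j; have [_ -> _ _] := tV (j + 2).
    by rewrite !ord4D addrA -(turn_perimeter _ cV eV tV) rpredD// lattice_turn.
have natt j : exists k : nat, turn V j = k%:R.
  by apply: int_ge0_nat; [exact: lattice_turn|exact/ltW].
have cE j : 0 < corner V j.
  have [_ e] := vertex_relations j tV.
  have p : 0 < t (j + 1) ^+ 2 + 4 by rewrite ltr_wpDl ?sqr_ge0.
  by rewrite -(pmulr_lgt0 _ p) e !mulr_gt0.
have natc j : exists k : nat, corner V j = k%:R.
  apply: int_ge0_nat; last exact/ltW.
  have [k kE] := natn j; have [l lE] := natn (j + 1).
  by rewrite /corner kE lE rpredD// ?lattice_dot// -natrM rpred_nat.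
have ntE j : 2 * turn V j = corner V j * t (j + 1).
  have [e1 e2] := vertex_relations j tV.
  have p : t (j + 1) ^+ 2 + 4 != 0 by rewrite gt_eqF// ltr_wpDl ?sqr_ge0.
  apply: (mulIf p); rewrite -mulrA e1 [RHS]mulrAC e2; ring.
have [a aE] := natn (i + 1); have [b bE] := natn (i + 2).
have [e eE] := natn (i + 3); have [d dE] := natn i.
have [N0 N0E] := natt i; have [N1 N1E] := natt (i + 1).
have [N2 N2E] := natt (i + 2); have [N3 N3E] := natt (i + 3).
have [m mE] := natc i; have [m' m'E] := natc (i + 1).
have m2 := corner_opp i tV; have m3 := corner_opp (i + 1) tV.
rewrite !ord4D in m3.
have r0 := ntE i; have r1 := ntE (i + 1); have r2 := ntE (i + 2); have r3 := ntE (i + 3).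
rewrite -?m3 -?m2 !ord4D mE m'E N0E N1E N2E N3E in r0 r1 r2 r3.
exists m, m', N0, N1, N2, N3; split=> //.
have [_ q0] := vertex_relations i tV; have [_ q1] := vertex_relations (i + 1) tV.
have [_ q2] := vertex_relations (i + 2) tV; have [_ q3] := vertex_relations (i + 3) tV.
rewrite -?m3 -?m2 !ord4D mE m'E ?aE ?bE ?eE ?dE in q0 q1 q2 q3.
apply: (@tangent_nat R (t (i + 1)) (t (i + 2)) (t (i +
  3)) (t i) m m' N0 N1 N2 N3 a b e d) => //.
- by rewrite -aE.
- by rewrite -bE.
- by rewrite -eE.
- by rewrite -dE.
- by rewrite -(ltr0n R) -mE.
- by rewrite -(ler_nat R) -mE -m'E.
- by rewrite -N0E -N2E (turn_perimeter _ cV eV tV); ring.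
- by rewrite -N1E -N3E; have := turn_perimeter (i + 1) cV eV tV; rewrite !ord4D => ->.
Qed.

Lemma tangent_classification V c t : ccw V -> lattice V -> equable V ->
  tangent_lengths V c t ->
  exists (s : 'I_4) (m m' n0 n1 n2 n3 : nat),
    [/\ (m, m', n0, n1, n2, n3) \in tangent_solutions,
        2 * n0%:R = m%:R * t s, 2 * n1%:R = m'%:R * t (s + 1),
        2 * n2%:R = m%:R * t (s + 2) & 2 * n3%:R = m'%:R * t (s + 3)].
Proof.
move=> cV lV eV tV.
(* Corners have period 2, so starting at 0 or at 1 achieves m <= m'. *)
have [i ci] : exists i, corner V i <= corner V (i + 1).
  have [c01|c10] := leP (corner V 0) (corner V 1); first by exists 0; rewrite add0r.
  by exists 1; rewrite ord4E -(add0r 2) -(corner_opp 0 tV) ltW.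
have [m [m' [n0 [n1 [n2 [n3 H]]]]]] := tangent_classification_at cV lV eV tV ci.
by exists (i + 1), m, m', n0, n1, n2, n3; rewrite !ord4D.
Qed.

End Classification.

(** * Congruence *)

Section Congruence.
Variable R : realType.
Implicit Types (V W : vertices R) (p q u v w c : plane R) (t : 'I_4 -> R).

Lemma tangent_vertex_norm V c t i : tangent_lengths V c t ->
  dot (c - V i) (c - V i) = t i ^+ 2 + 4.
Proof.
move=> tV; have [_ _ di ci] := tV i.
have [-> _] := dist_vertex (lt0r_neq0 (tangent_side_gt0 i tV)) di ci; ring.
Qed.

(* The position, relative to the centre, of the vertex following one at [w]; [x]
   and [y] are their tangent lengths. *)
Definition tangent_step (x y : R) w : plane R :=
  w - ((x + y) / (x ^+ 2 + 4)) *: (x *: w + 2 *: (w.2, - w.1)).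

(** The edge is recovered from its dot and cross products with [c - V i], a vector of squared length
    t_i^2 + 4. *)
Lemma tangent_next V c t i : tangent_lengths V c t ->
  V (i + 1) - c = tangent_step (t i) (t (i + 1)) (V i - c).
Proof.
move=> tV; pose w := V i - c; have [_ ai di ci] := tV i.
have N := tangent_vertex_norm i tV.
have N0 : t i ^+ 2 + 4 != 0 by rewrite gt_eqF// ltr_wpDl ?sqr_ge0.
have E1 : (V (i + 1) - c).1 * (t i ^+ 2 + 4) =
  w.1 * (t i ^+ 2 + 4) - (t i + t (i + 1)) * (t i * w.1 + 2 * w.2).
  rewrite -N -ai.
  transitivity (w.1 * dot (c - V i) (c - V i) +
     (dot (edge V i) (c - V i) * (- w.1) - cross (edge V i) (c - V i) * w.2)).
    by rewrite /w /dot /cross /edge !planeE; ring.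
  by rewrite di ci; ring.
have E2 : (V (i + 1) - c).2 * (t i ^+ 2 + 4) =
  w.2 * (t i ^+ 2 + 4) - (t i + t (i + 1)) * (t i * w.2 - 2 * w.1).
  rewrite -N -ai.
  transitivity (w.2 * dot (c - V i) (c - V i) +
     (dot (edge V i) (c - V i) * (- w.2) + cross (edge V i) (c - V i) * w.1)).
    by rewrite /w /dot /cross /edge !planeE; ring.
  by rewrite di ci; ring.
rewrite [LHS]surjective_pairing [RHS]surjective_pairing; congr pair; apply: (mulIf N0).
- by rewrite E1 /w !planeE; field.
- by rewrite E2 /w !planeE; field.
Qed.

Lemma angle_exists (x y : R) : x ^+ 2 + y ^+ 2 = 1 ->
  exists theta : R, cos theta = x /\ sin theta = y.
Proof.
move=> xy; have x1 : -1 <= x <= 1.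
  by rewrite -ler_norml -(@expr_le1 _ 2)// real_normK ?num_real// -xy lerDl sqr_ge0.
have s : sin (acos x) = `|y|.
  by rewrite sin_acos// -sqrtr_sqr -xy addrAC subrr add0r.
have c : cos (acos x) = x by rewrite acosK// in_itv.
have [y0|y0] := leP 0 y.
- by exists (acos x); rewrite c s ger0_norm.
- by exists (- acos x); rewrite cosN sinN c s ltr0_norm// opprK.
Qed.

(** The rotation is chosen to take [V 0 - c] to [W k - c'], which have equal lengths. Since
    [tangent_step] commutes with rotations, the other vertices follow one by one. *)
Lemma tangent_motion V W c c' t t' k : tangent_lengths V c t ->
  tangent_lengths W c' t' -> (forall i, t i = t' (k + i)) ->
  exists2 f, euclidean_motion f & forall i, W (k + i) = f (V i).
Proof.
move=> tV tW tt.
pose v := V 0 - c; pose w := W k - c'; pose n := t 0 ^+ 2 + 4.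
have n0 : n != 0 by rewrite gt_eqF// ltr_wpDl ?sqr_ge0.
have vn : dot v v = n.
  by rewrite /n -(tangent_vertex_norm 0 tV) /v /dot !planeE; ring.
have wn : dot w w = n.
  by rewrite /n tt addr0 -(tangent_vertex_norm k tW) /w /dot !planeE; ring.
have [theta [ct st]] : exists theta : R, cos theta = dot v w / n /\ sin theta =
  cross v w / n.
  apply: angle_exists; rewrite !expr_div_n -mulrDl.
  have -> : dot v w ^+ 2 + cross v w ^+ 2 = dot v v * dot w w by rewrite /dot /cross;
    ring.
  by rewrite vn wn -expr2 divff// expf_neq0.
exists (translation (c' - c) \o rotation c theta).
  by apply: motion_comp; [exact: motion_translation|exact: motion_rotation].
pose r p : plane R := (cos theta * p.1 - sin theta * p.2, sin theta * p.1 +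
  cos theta * p.2).
suff H i : W (k + i) - c' = r (V i - c).
  move=> i; rewrite -(subrK c' (W (k + i))) H /= /translation /rotation -/(r (V i - c)).
  by rewrite [c + r _]addrC -addrA (addrC c) subrK.
have H0 : W (k + 0) - c' = r (V 0 - c).
  rewrite addr0 -/w -/v /r ct st [LHS]surjective_pairing; congr pair; apply: (mulIf n0).
  - rewrite -{1}vn; transitivity (dot v w * v.1 - cross v w * v.2); last by field.
    by rewrite /dot /cross; ring.
  - rewrite -{1}vn; transitivity (cross v w * v.1 + dot v w * v.2); last by field.
    by rewrite /dot /cross; ring.
have HS j : W (k + j) - c' = r (V j - c) -> W (k + (j + 1)) - c' = r (V (j + 1) - c).
  rewrite (addrA k j 1) (tangent_next _ tW) (tangent_next _ tV) -(addrA k j 1) -!tt => ->.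
  move: (V j - c) (t j) (t (j + 1)) => p x y; rewrite /tangent_step.
  move: ((x + y) / _) => z.
  by rewrite /r [LHS]surjective_pairing !planeE; congr pair; ring.
have H1 := HS _ H0; rewrite ord4E in H1.
have H2 := HS _ H1; rewrite ord4E in H2.
have H3 := HS _ H2; rewrite ord4E in H3.
by elim/ord4_ind: i.
Qed.

Lemma reflection_x_axis p : reflection (0, 0) (1, 0) p = (p.1, - p.2).
Proof.
rewrite /reflection /dot [LHS]surjective_pairing !planeE; congr pair; by field.
Qed.

(** A reflection reverses the orientation and listing the vertices backwards restores it; this
    reduces reversed labellings to [tangent_motion]. *)
Lemma tangent_mirror V c t : tangent_lengths V c t ->
  tangent_lengths (fun i => reflection (0, 0) (1, 0) (V (- i)))
    (reflection (0, 0) (1, 0) c) (fun i => t (- i)).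
Proof.
move=> tV i; have [j jE] : exists j, - i = j + 1 by exists (- i - 1); rewrite subrK.
have jE' : - (i + 1) = j by rewrite opprD jE addrK.
set V' := fun i => reflection (0, 0) (1, 0) (V (- i)).
have [tj aj dj cj] := tV j; have [tj1 _ _ _] := tV (j + 1).
have sE : side_length V' i = side_length V j.
  by apply: dist_eq; rewrite /V' jE jE' !reflection_x_axis /dot !planeE; ring.
rewrite sE jE jE'; split=> //.
- by rewrite addrC.
- transitivity (dot (edge V j) (edge V j) - dot (edge V j) (c - V j)).
    by rewrite /edge /V' jE jE' !reflection_x_axis /dot !planeE; ring.
  by rewrite -sqr_side dj expr2 -mulrBl {1}aj addrAC subrr add0r.
- rewrite -cj /edge /V' jE jE' !reflection_x_axis /cross !planeE; ring.
Qed.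

Lemma tangent_congruent V W c c' t t' k : tangent_lengths V c t ->
  tangent_lengths W c' t' ->
  (forall i, t i = t' (k + i)) \/ (forall i, t i = t' (k - i)) -> congruent V W.
Proof.
move=> tV tW [tt|tt].
  by have [f mf H] := tangent_motion tV tW tt; exists f => //; exists k; left.
have [|f mf H] := @tangent_motion _ _ _ _ _ _ k (tangent_mirror tV) tW.
  by move=> i /=; rewrite tt opprK.
exists (f \o reflection (0, 0) (1, 0)).
  apply: motion_comp mf (motion_reflection _).
  by move=> /(congr1 fst) /= /eqP; rewrite eq_sym oner_eq0.
by exists k; right => i; rewrite H opprK.
Qed.

End Congruence.

(** * From tangent lengths back to the quadrilateral *)

Section Converse.
Variable R : realType.
Implicit Types (V W : vertices R) (p q r u v w c : plane R) (t : 'I_4 -> R).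

Lemma tangent_ccw V c t : tangent_lengths V c t -> ccw V.
Proof.
move=> tV i; have [e _] := vertex_relations i tV.
have p : 0 < t (i + 1) ^+ 2 + 4 by rewrite ltr_wpDl ?sqr_ge0.
rewrite -(pmulr_lgt0 _ p) e; have [t0 _ _ _] := tV (i + 1).
by rewrite !mulr_gt0// (tangent_side_gt0 _ tV).
Qed.

Lemma collinear_cross p q r : collinear p q r -> cross (q - p) (r - p) = 0.
Proof.
move=> [a [b [_ [x _ <-] [y _ <-] [z _ <-]]]].
by rewrite /cross !planeE; ring.
Qed.

(** Any three distinct vertices are consecutive up to order, so their cross product is plus or minus
    a turn. Sides do not cross because [half_plane V i] vanishes on side [i] and is positive inside
    the other sides. *)
Lemma ccw_quadrilateral V : ccw V -> quadrilateral V.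
Proof.
move=> cV; split=> [i j k|i j ij].
  rewrite -(subrK i j) -(subrK i k) !(addrC _ i).
  move: (j - i) (k - i) => x y ix xy iy /collinear_cross C.
  have t0 := cV i; have t1 := cV (i + 1); have t2 := cV (i + 2); have t3 := cV (i + 3).
  have nx0 : x != 0 by apply: contraNneq ix => ->; rewrite addr0.
  have ny0 : y != 0 by apply: contraNneq iy => ->; rewrite addr0.
  have {}xy : x != y by apply: contraNneq xy => ->.
  have nt (z : R) : z = 0 -> 0 < z -> False by move=> ->; rewrite ltxx.
  have pt (z : R) : - z = 0 -> 0 < z -> False by move=> /eqP;
    rewrite oppr_eq0 => /eqP ->; rewrite ltxx.
  rewrite /turn !ord4D in t0 t1 t2 t3.
  move: nx0 ny0 xy C; elim/ord4_ind: x {ix} => //; elim/ord4_ind: y {iy} => // _ _ _ C.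
  - by apply: nt t0.
  - by apply: nt t3; rewrite -C /cross !planeE; ring.
  - by apply: pt t0; rewrite -C /cross !planeE; ring.
  - by apply: nt t2; rewrite -C /cross !planeE; ring.
  - by apply: pt t3; rewrite -C /cross !planeE; ring.
  - by apply: pt t2; rewrite -C /cross !planeE; ring.
apply/seteqP; split=> // p [[x /=]]; rewrite in_itv/= => /andP[x0 x1] <- [y].
rewrite /= in_itv/= => /andP[y0 y1] e.
have [h0 h1 h2 h3] := half_plane_vertex V i.
have := congr1 (half_plane V i) e; rewrite !half_plane_segment h0 h1 !mulr0 addr0.
have {}y1 : 0 < 1 - y by rewrite subr_gt0.
have t0 := cV i; have t3 := cV (i + 3).
apply/eqP; rewrite gt_eqF//.
move: ij; rewrite -(subrK i j) (addrC _ i).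
elim/ord4_ind: (j - i); rewrite ?addr0 ?eqxx// => _; rewrite !ord4D.
- by rewrite h1 h2 mulr0 add0r mulr_gt0.
- by rewrite h2 h3 addr_gt0// mulr_gt0.
- by rewrite h3 h0 mulr0 addr0 mulr_gt0.
Qed.

Lemma ccw_convex V : ccw V -> convex V.
Proof.
move=> cV; rewrite /convex region_ccw// => x y l; rewrite !inE/= => Hx Hy i.
have l0 : 0 <= l%:num by [].
have l1 : 0 <= 1 - l%:num by rewrite subr_ge0.
have -> : half_plane V i (conv l x y) = l%:num * half_plane V i x +
  (1 - l%:num) * half_plane V i y.
  have -> : conv l x y = l%:num *: (x : plane R) + (1 - l%:num) *: (y : plane R) by [].
  by rewrite /half_plane /cross !planeE; ring.
by rewrite addr_ge0// mulr_ge0.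
Qed.

Lemma tangent_tangential V c t : tangent_lengths V c t -> tangential V.
Proof.
move=> tV; have cV := tangent_ccw tV; exists c, 2; split=> //.
  rewrite region_ccw// => p cp i /=; have [_ _ _ ci] := tV i.
  have a0 := tangent_side_gt0 i tV.
  have -> : half_plane V i p = 2 * side_length V i + cross (edge V i) (p - c).
    by rewrite -ci /half_plane /edge /cross !planeE; ring.
  (* Cauchy-Schwarz: a point of the circle is at most 2 closer to the side than the centre is. *)
  have : cross (edge V i) (p - c) ^+ 2 <= (2 * side_length V i) ^+ 2.
    rewrite exprMn sqr_side -{1}cp sqr_dist -subr_ge0.
    have -> : dot (p - c) (p - c) * dot (edge V i) (edge V i) - cross (edge V i) (p -
      c) ^+ 2 =
       dot (edge V i) (p - c) ^+ 2 by rewrite /dot /cross; ring.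
    exact: sqr_ge0.
  have y0 : 0 <= 2 * side_length V i by rewrite mulr_ge0// ltW.
  rewrite -[X in X <= _](real_normK (num_real _)) ler_pXn2r ?nnegrE// ler_norml =>
    /andP[x1 _].
  by rewrite -lerBlDl sub0r.
move=> i; have [ti ai di ci] := tV i.
have a0 := tangent_side_gt0 i tV; have tj : 0 < t (i + 1) by have [] := tV (i + 1).
have [N _] := dist_vertex (lt0r_neq0 a0) di ci.
pose pt (s : R) : plane R := (1 - s) *: V i + s *: V (i + 1).
(* The squared distance along the line equals 4 only where s times the side length is [t i], so this
   is the only common point with the circle. *)
have dE s : dist c (pt s) ^+ 2 = 4 + (t i - s * side_length V i) ^+ 2.
  rewrite sqr_dist; transitivity (dot (c - V i) (c - V i) - 2 * s * dot (edge V i) (c -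
    V i) + s ^+ 2 * dot (edge V i) (edge V i)).
    by rewrite /pt /dot /edge !planeE; ring.
  by rewrite N di -sqr_side; ring.
pose s0 := t i / side_length V i.
have s0E : s0 * side_length V i = t i by rewrite divfK// gt_eqF.
exists (pt s0).
  have s01 : 0 <= s0 <= 1.
    rewrite divr_ge0 ?(ltW ti) ?(ltW a0)//= ler_pdivrMr// mul1r ai lerDl ltW//.
  by exists s0 => //=; rewrite in_itv.
apply/seteqP; split=> q /=.
  move=> [cq [s _ qE]]; have := dE s; rewrite /pt qE cq.
  move=> /eqP; rewrite -natrX -subr_eq0 opprD addrA subrr sub0r oppr_eq0 sqrf_eq0
    subr_eq0 => /eqP e.
  rewrite -qE /pt; suff -> : s = s0 by [].
  by rewrite /s0 e mulfK// gt_eqF.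
move=> ->; split; last by exists s0.
by apply/eqP; rewrite -(eqrXn2 (n := 2))// ?dist_ge0// dE s0E subrr expr0n addr0 -natrX.
Qed.

Lemma tangent_equable V c t : tangent_lengths V c t -> equable V.
Proof.
move=> tV; have cV := tangent_ccw tV.
rewrite /equable ccw_area//; congr EFin.
rewrite -(half_plane_sum V c) /perimeter mulr_suml; apply: eq_bigr => i _.
by have [_ _ _ ci] := tV i; rewrite /half_plane -/(edge V i) ci mulrAC divff ?pnatr_eq0//
  mul1r.
Qed.

Lemma tangent_LEQ V c t : lattice V -> tangent_lengths V c t -> convex_tangential_LEQ V.
Proof.
move=> lV tV; have cV := tangent_ccw tV; split.
- by split=> //; [exact: ccw_quadrilateral|exact: tangent_equable tV].
- exact: ccw_convex.
- exact: tangent_tangential tV.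
Qed.

Lemma motion_dist f p q : euclidean_motion f -> dist (f p) (f q) = dist p q.
Proof.
move=> mf; elim: mf p q => {f} [v|c th|a b ab|f g _ Hf _ Hg|f g _ Hf fg gf] p q.
- by apply: dist_eq; rewrite /translation /dot !planeE; ring.
- apply: dist_eq; rewrite /rotation; set C := cos th; set S := sin th.
  have CS : C ^+ 2 + S ^+ 2 = 1 by exact: cos2Dsin2.
  rewrite -[RHS]mul1r -CS /dot !planeE; ring.
- have n0 : dot (b - a) (b - a) != 0.
    by apply/eqP => /dot_eq0/eqP; rewrite subr_eq0 => /eqP /esym.
  apply: dist_eq; rewrite /reflection.
  set k := dot (p - a) _ / _; set l := dot (q - a) _ / _.
  have kl : (l - k) * dot (b - a) (b - a) = dot (q - p) (b - a).
    rewrite mulrBl !divfK// /dot !planeE; ring.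
  transitivity (dot (q - p) (q - p) + 4 * (l - k) * ((l - k) * dot (b - a) (b - a) -
    dot (q - p) (b - a))).
    by rewrite /dot !planeE; ring.
  by rewrite kl subrr mulr0 addr0.
- by rewrite /= Hf Hg.
- by rewrite -Hf !gf.
Qed.

Lemma congruent_sum_sqr V W : congruent V W ->
  \sum_i side_length V i ^+ 2 = \sum_i side_length W i ^+ 2.
Proof.
move=> [f mf [k [H|H]]].
- rewrite [RHS](reindex_inj (addrI k)); apply: eq_bigr => i _; congr (_ ^+ 2).
  by rewrite /side_length -addrA !H motion_dist.
(* Sending vertex [i] to vertex [k - i] sends side [i] to side [k - i - 1], since a side is indexed
   by its first endpoint. *)
- have inj : injective (fun i : 'I_4 => k - i - 1) by move=> i j /addIr /addrI /oppr_inj.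
  rewrite [RHS](reindex_inj inj); apply: eq_bigr => i _; congr (_ ^+ 2).
  have -> : k - i - 1 = k - (i + 1) by rewrite opprD addrA.
  by rewrite /side_length {2}opprD addrA subrK !H motion_dist// distC.
Qed.

End Converse.

(** * The six examples *)

Section Examples.
Variable R : realType.
Implicit Types (V W : vertices R) (p q r u v w c : plane R) (t : 'I_4 -> R).

(** Vertices are listed counterclockwise, as [tangent_lengths] requires, so the sides of the last
    example appear as 41, 5, 1, 37. The starting vertices make sides 1 and 3 the bases of both
    trapezoids. *)
Definition example (i : 'I_6) : vertices R := fun j =>
  nth (0, 0) (nth [::]
   [:: [:: (0, 0); (4, 0); (4, 4); (0, 4)];
       [:: (8, 0); (5, 4); (3, 4); (0, 0)];
       [:: (6, 0); (3, 4); (0, 4); (0, 0)];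
       [:: (0, 0); (5, 0); (8, 4); (3, 4)];
       [:: (0, 0); (3, 0); (3, 3); (-9, 12)];
       [:: (0, 0); (40, 9); (36, 12); (35, 12)]] i) j.

Definition example_center (i : 'I_6) : plane R :=
  nth (0, 0) [:: (2, 2); (4, 2); (2, 2); (4, 2); (1, 2); (106 / 3, 10)] i.

Definition example_lengths (i : 'I_6) (j : 'I_4) : R :=
  nth 0 (nth [::]
   [:: [:: 2; 2; 2; 2]; [:: 4; 1; 1; 4]; [:: 4; 1; 2; 2]; [:: 4; 1; 4; 1];
       [:: 1; 2; 1; 14]; [:: 110 / 3; 13 / 3; 2 / 3; 1 / 3]] i) j.

Lemma ord6_ind (P : 'I_6 -> Prop) : P 0 -> P 1 -> P 2 -> P 3 -> P 4 -> P 5 ->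
  forall i, P i.
Proof.
move=> P0 P1 P2 P3 P4 P5 [[|[|[|[|[|[|//]]]]]] lti].
- by rewrite (_ : Ordinal lti = 0)//; apply: val_inj.
- by rewrite (_ : Ordinal lti = 1)//; apply: val_inj.
- by rewrite (_ : Ordinal lti = 2)//; apply: val_inj.
- by rewrite (_ : Ordinal lti = 3)//; apply: val_inj.
- by rewrite (_ : Ordinal lti = 4)//; apply: val_inj.
- by rewrite (_ : Ordinal lti = 5)//; apply: val_inj.
Qed.

Lemma val4E : ((nat_of_ord (0 : 'I_4)%R = 0%N) * (nat_of_ord (1 : 'I_4)%R = 1%N) *
  (nat_of_ord (2 : 'I_4)%R = 2%N) * (nat_of_ord (3 : 'I_4)%R = 3%N))%type.
Proof. by []. Qed.

Lemma val6E : ((nat_of_ord (0 : 'I_6)%R = 0%N) * (nat_of_ord (1 : 'I_6)%R = 1%N) *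
  (nat_of_ord (2 : 'I_6)%R = 2%N) * (nat_of_ord (3 : 'I_6)%R = 3%N) *
  (nat_of_ord (4 : 'I_6)%R = 4%N) * (nat_of_ord (5 : 'I_6)%R = 5%N))%type.
Proof. by []. Qed.

Lemma tangent_lengthsI V c t : (forall i, [/\ 0 < t i,
    dot (edge V i) (edge V i) = (t i + t (i + 1)) ^+ 2,
    dot (edge V i) (c - V i) = t i * (t i + t (i + 1)) &
    cross (edge V i) (c - V i) = 2 * (t i + t (i + 1))]) ->
  tangent_lengths V c t.
Proof.
move=> H i; have [t0 e d x] := H i; have [t1 _ _ _] := H (i + 1).
have s : side_length V i = t i + t (i + 1).
  by rewrite /side_length /dist e sqrtr_sqr ger0_norm// addr_ge0// ltW.
by rewrite s.
Qed.

Lemma example_tangent i :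
  tangent_lengths (example i) (example_center i) (example_lengths i).
Proof.
apply: tangent_lengthsI => j; rewrite /edge /dot /cross.
elim/ord6_ind: i; elim/ord4_ind: j; rewrite !ord4E /example /example_center
  /example_lengths !val4E !val6E /=;
 split; by [rewrite ?divr_gt0|field].
Qed.

Lemma example_lattice i : lattice (example i).
Proof.
move=> j; elim/ord6_ind: i; elim/ord4_ind: j; rewrite /example !val4E !val6E /=;
  split; rewrite ?rpredN ?rpred_nat ?rpred0//.
Qed.

Lemma example_side i j :
  side_length (example i) j = example_lengths i j + example_lengths i (j + 1).
Proof. by have [] := example_tangent i j. Qed.

Lemma example_congruent i j : congruent (example i) (example j) -> i = j.
Proof.
move=> /congruent_sum_sqr.
(* The sums of squared sides, which separate the six examples; the perimeter would not, being 20 for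
   both the isosceles trapezoid and the rhombus. *)
pose s := [:: 64; 118; 86; 100; 468; 3076]%N.
have H k : \sum_l side_length (example k) l ^+ 2 = (nth 0%N s k)%:R.
  rewrite sum4 !example_side !ord4E /example_lengths.
  by elim/ord6_ind: k; rewrite !val4E !val6E /s /=; field.
by rewrite !H => /eqP; rewrite eqr_nat nth_uniq// => /eqP /val_inj.
Qed.

Lemma example_complete V : convex_tangential_LEQ V -> exists i, congruent V (example i).
Proof.
wlog cV : V / ccw V => [H VL|].
  have [[qV _ _] cV _] := VL; have [|cV'] := convex_ccw qV cV; first by move/H; apply.
  by have [i /congruent_rev] := H _ cV' (convex_tangential_LEQ_rev VL); exists i.
move=> [[_ lV eV] _ gV]; have [c [t tV]] := tangential_lengths cV gV eV.
have [s [m [m' [n0 [n1 [n2 [n3 [sol e0 e1 e2 e3]]]]]]]] := tangent_classification cV lV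
  eV tV.
suff [i [k H]] : exists i (k : 'I_4), (forall j, t (s + j) = example_lengths i (k + j)) \/
    (forall j, t (s + j) = example_lengths i (k - j)).
  exists i; case: H => H.
  - apply: (tangent_congruent tV (example_tangent i) (k := k - s)); left => j.
    by rewrite -[in LHS](subrK s j) (addrC _ s) H addrA (addrAC k).
  - apply: (tangent_congruent tV (example_tangent i) (k := k + s)); right => j.
    by rewrite -[in LHS](subrK s j) (addrC _ s) H opprB addrA.
(* Each of the sixteen solutions is the cyclic list of tangent lengths of example [i], read from
   position [k] either forwards ([plus]) or backwards ([minus]). *)
have plus i k : t s = example_lengths i k -> t (s + 1) = example_lengths i (k + 1) ->
    t (s + 2) = example_lengths i (k + 2) -> t (s + 3) = example_lengths i (k + 3) ->
    exists i (k : 'I_4), (forall j, t (s + j) = example_lengths i (k + j)) \/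
      (forall j, t (s + j) = example_lengths i (k - j)).
  by move=> h0 h1 h2 h3; exists i, k; left; elim/ord4_ind; rewrite ?addr0.
have minus i k : t s = example_lengths i k -> t (s + 1) = example_lengths i (k - 1) ->
    t (s + 2) = example_lengths i (k - 2) -> t (s + 3) = example_lengths i (k - 3) ->
    exists i (k : 'I_4), (forall j, t (s + j) = example_lengths i (k + j)) \/
      (forall j, t (s + j) = example_lengths i (k - j)).
  by move=> h0 h1 h2 h3; exists i, k; right; elim/ord4_ind; rewrite ?subr0 ?addr0.
move: sol e0 e1 e2 e3; rewrite /tangent_solutions !in_cons in_nil orbF.
move=> /predU1P[[-> -> -> -> -> ->] e0 e1 e2 e3|].
  by apply: (plus 5 2); rewrite ?ord4E /example_lengths !val4E !val6E /=; lra.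
move=> /predU1P[[-> -> -> -> -> ->] e0 e1 e2 e3|].
  by apply: (minus 5 2); rewrite ?ord4E /example_lengths !val4E !val6E /=; lra.
move=> /predU1P[[-> -> -> -> -> ->] e0 e1 e2 e3|].
  by apply: (plus 4 1); rewrite ?ord4E /example_lengths !val4E !val6E /=; lra.
move=> /predU1P[[-> -> -> -> -> ->] e0 e1 e2 e3|].
  by apply: (plus 4 3); rewrite ?ord4E /example_lengths !val4E !val6E /=; lra.
move=> /predU1P[[-> -> -> -> -> ->] e0 e1 e2 e3|].
  by apply: (minus 5 0); rewrite ?ord4E /example_lengths !val4E !val6E /=; lra.
move=> /predU1P[[-> -> -> -> -> ->] e0 e1 e2 e3|].
  by apply: (plus 5 0); rewrite ?ord4E /example_lengths !val4E !val6E /=; lra.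
move=> /predU1P[[-> -> -> -> -> ->] e0 e1 e2 e3|].
  by apply: (plus 3 0); rewrite ?ord4E /example_lengths !val4E !val6E /=; lra.
move=> /predU1P[[-> -> -> -> -> ->] e0 e1 e2 e3|].
  by apply: (minus 2 2); rewrite ?ord4E /example_lengths !val4E !val6E /=; lra.
move=> /predU1P[[-> -> -> -> -> ->] e0 e1 e2 e3|].
  by apply: (plus 2 2); rewrite ?ord4E /example_lengths !val4E !val6E /=; lra.
move=> /predU1P[[-> -> -> -> -> ->] e0 e1 e2 e3|].
  by apply: (plus 2 0); rewrite ?ord4E /example_lengths !val4E !val6E /=; lra.
move=> /predU1P[[-> -> -> -> -> ->] e0 e1 e2 e3|].
  by apply: (minus 2 0); rewrite ?ord4E /example_lengths !val4E !val6E /=; lra.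
move=> /predU1P[[-> -> -> -> -> ->] e0 e1 e2 e3|].
  by apply: (plus 0 0); rewrite ?ord4E /example_lengths !val4E !val6E /=; lra.
move=> /predU1P[[-> -> -> -> -> ->] e0 e1 e2 e3|].
  by apply: (plus 1 1); rewrite ?ord4E /example_lengths !val4E !val6E /=; lra.
move=> /predU1P[[-> -> -> -> -> ->] e0 e1 e2 e3|].
  by apply: (plus 1 2); rewrite ?ord4E /example_lengths !val4E !val6E /=; lra.
move=> /predU1P[[-> -> -> -> -> ->] e0 e1 e2 e3|].
  by apply: (plus 1 0); rewrite ?ord4E /example_lengths !val4E !val6E /=; lra.
move=> /eqP[-> -> -> -> -> ->] e0 e1 e2 e3.
by apply: (plus 1 3); rewrite ?ord4E /example_lengths !val4E !val6E /=; lra.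
Qed.

End Examples.

Theorem corollary1 (R : realType) :
  exists Q : 'I_6 -> vertices R,
    (forall i, convex_tangential_LEQ (Q i)) /\
    (square (Q 0) /\ has_sides (Q 0) 4 4 4 4) /\
    (isosceles_trapezoid (Q 1) /\ has_sides (Q 1) 5 2 5 8) /\
    (right_trapezoid (Q 2) /\ has_sides (Q 2) 5 3 4 6) /\
    (rhombus (Q 3) /\ has_sides (Q 3) 5 5 5 5) /\
    (kite (Q 4) /\ has_sides (Q 4) 3 3 15 15) /\
    ([/\ Q 5 0 = (0, 0), Q 5 1 = (40, 9), Q 5 2 = (36, 12)
       & Q 5 3 = (35, 12)] /\
     has_sides (Q 5) 41 5 1 37) /\
    (forall i j, congruent (Q i) (Q j) -> i = j) /\
    (forall V : vertices R, convex_tangential_LEQ V ->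
       exists i, congruent V (Q i)).
Proof.
have sides (i : 'I_6) (l0 l1 l2 l3 : R) : l0 =
  example_lengths R i 0 + example_lengths R i 1 ->
    l1 = example_lengths R i 1 + example_lengths R i 2 ->
    l2 = example_lengths R i 2 + example_lengths R i 3 ->
    l3 = example_lengths R i 3 + example_lengths R i 0 ->
    has_sides (example R i) l0 l1 l2 l3.
  by move=> -> -> -> ->; split; rewrite example_side ord4E.
exists (example R); split.
  by move=> i; exact: tangent_LEQ (example_lattice R i) (example_tangent R i).
split; first split.
- split=> [i j|i].
    rewrite !example_side /example_lengths.
    by elim/ord4_ind: i; elim/ord4_ind: j; rewrite ?ord4E !val4E !val6E.
  by elim/ord4_ind: i; rewrite /right_angle !ord4E /example !val4E !val6E /dot /=; ring.
- by apply: sides; rewrite /example_lengths !val4E !val6E /=; ring.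
split; first split.
- split; last by rewrite !example_side /example_lengths !ord4E !val4E !val6E /=; ring.
  split; rewrite /parallel /edge !ord4E /example !val4E !val6E /=; first by ring.
  lra.
- by apply: sides; rewrite /example_lengths !val4E !val6E /=; ring.
split; first split.
- split.
    split; rewrite /parallel /edge !ord4E /example !val4E !val6E /=; first by ring.
    lra.
  by exists 2; rewrite /right_angle !ord4E /example !val4E !val6E /dot /=; ring.
- by apply: sides; rewrite /example_lengths !val4E !val6E /=; ring.
split; first split.
- move=> i j; rewrite !example_side /example_lengths.
  by elim/ord4_ind: i; elim/ord4_ind: j; rewrite ?ord4E !val4E !val6E /=; ring.
- by apply: sides; rewrite /example_lengths !val4E !val6E /=; ring.
split; first split.
- by split; rewrite !example_side /example_lengths !ord4E !val4E !val6E /=; ring.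
- by apply: sides; rewrite /example_lengths !val4E !val6E /=; ring.
split; first split.
- by split; rewrite /example !val4E !val6E.
- by apply: sides; rewrite /example_lengths !val4E !val6E /=; field.
split; first exact: example_congruent.
exact: example_complete.
Qed.
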